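(* Let $\mathcal{M}$ be a multicategory. Then $[\mathcal{M}]$, whose cells are the terms of $T(\mathcal{M})$ considered modulo the convertibility relation $\stackrel{*}{\leftrightarrow}$, is a (single-object) virtual double category.
   Context: **Multicategory notation.** Fix a multicategory $\mathcal{M}$ with set of objects $\mathcal{M}_0$. Morphisms are written in sequent notation: $x_1{:}A_1,\ldots,x_n{:}A_n \vdash v : A$ ($n \ge 0$, distinct variables) denotes a morphism $v \in \mathcal{M}(A_1,\ldots,A_n;A)$; $x{:}A \vdash x : A$ denotes the identity, and for $\Gamma_i \vdash v_i : A_i$ the substitution $v[v_1,\ldots,v_n/x_1,\ldots,x_n]$ denotes the composite $v \circ (v_1,\ldots,v_n)$; expressions denoting the same morphism of $\mathcal{M}$ are identified. Contexts $\Gamma$ are ordered lists of typed variables without repeated variables. $\mathcal{M}_0^{\circ\bullet} = (\mathcal{M}_0 \times \{\circ,\bullet\})^*$ is the free monoid on polarised objects $A^\circ, A^\bullet$, with empty word $\lambda$ (also written $I$). **Terms.** $T(\mathcal{M})$ consists of the terms $t$ with $\Gamma \Vdash t : (U,B,W)$ (where $U,W \in \mathcal{M}_0^{\circ\bullet}$, $B \in \mathcal{M}_0$) derivable by the following rules (bound variables may be renamed): - (seq) if $\Gamma \vdash v : A$ then $\Gamma \Vdash [v] : (\lambda,A,\lambda)$; - (let) if $n \ge 1$, $\Gamma_i \Vdash t_i : (U_{i-1},A_i,U_i)$ for $1 \le i \le n$, and $x_1{:}A_1,\ldots,x_n{:}A_n \Vdash t : (V,B,W)$, then $\Gamma_1,\ldots,\Gamma_n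 \Vdash \mathsf{let}\ x_1,\ldots,x_n \downarrow (t_1 \mid \cdots \mid t_n)\ \mathsf{in}\ t : (U_0V,B,U_nW)$; - (putR) if $\Delta \Vdash t : (U,B,W)$ and $\Gamma \vdash v : A$ then $\Delta,\Gamma \Vdash \mathsf{putR}(v,t) : (U,B,A^\circ W)$; - (getL) if $x{:}A,\Gamma \Vdash t : (U,B,W)$ then $\Gamma \Vdash \mathsf{getL}(x.t) : (A^\circ U,B,W)$; - (getR) if $\Gamma,x{:}A \Vdash t : (U,B,W)$ then $\Gamma \Vdash \mathsf{getR}(x.t) : (U,B,A^\bullet W)$; - (putL) if $\Gamma \vdash v : A$ and $\Delta \Vdash t : (U,B,W)$ then $\Gamma,\Delta \Vdash \mathsf{putL}(v,t) : (A^\bullet U,B,W)$. **Value substitution.** For $\Gamma_i \vdash v_i : A_i$ ($1\le i\le n$) and $x_1{:}A_1,\ldots,x_n{:}A_n \Vdash t : (U,B,W)$, the term $\Gamma_1,\ldots,\Gamma_n \Vdash t[\overline v/\overline x] : (U,B,W)$ is defined by recursion: $[u][\overline v/\overline x] = [u[\overline v/\overline x]]$; $\mathsf{putR}(u,s)[\overline v/\overline x] = \mathsf{putR}(u[\overline{v_2}/\overline{x_2}],s[\overline{v_1}/\overline{x_1}])$ and $\mathsf{putL}(u,s)[\overline v/\overline x] = \mathsf{putL}(u[\overline{v_1}/\overline{x_1}],s[\overline{v_2}/\overline{x_2}])$, where $\overline x = \overline{x_1},\overline{x_2}$ is split as dictated by the typing rule (and $\overline v$ accordingly); $\mathsf{getL}(y.s)[\overline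 v/\overline x] = \mathsf{getL}(y.s[\overline v/\overline x])$ and $\mathsf{getR}(y.s)[\overline v/\overline x] = \mathsf{getR}(y.s[\overline v/\overline x])$ ($y$ being substituted for itself); $(\mathsf{let}\ \overline y \downarrow (t_1 \mid \cdots \mid t_m)\ \mathsf{in}\ s)[\overline v/\overline x] = \mathsf{let}\ \overline y \downarrow (t_1[\overline{v_1}/\overline{x_1}] \mid \cdots \mid t_m[\overline{v_m}/\overline{x_m}])\ \mathsf{in}\ s$ with $\overline x$ split into the contexts $\overline{x_j}$ of the $t_j$. Variables substituted for themselves may be omitted, as in $t[v/y]$. **Rewriting.** $\to$ is the least relation on terms closed under all term formers (i.e. under rewriting subterms) containing (where $\overline a,\overline b$ are possibly empty sequences of terms): - [R0] $\mathsf{let}\ x_1,\ldots,x_n \downarrow ([v_1] \mid \cdots \mid [v_n])\ \mathsf{in}\ t \to t[v_1,\ldots,v_n/x_1,\ldots,x_n]$ - [R1] $\mathsf{let}\ \overline x \downarrow (\overline a \mid \mathsf{putR}(v,t) \mid \mathsf{getL}(y.s) \mid \overline b)\ \mathsf{in}\ r \to \mathsf{let}\ \overline x \downarrow (\overline a \mid t \mid s[v/y] \mid \overline b)\ \mathsf{in}\ r$ - [R2] $\mathsf{let}\ \overline x \downarrow (\overline a \mid \mathsf{getR}(y.t) \mid \mathsf{putL}(v,s) \mid \overline b)\ \mathsf{in}\ r \to \mathsf{let}\ \overline x \downarrow (\overline a \mid t[v/y] \mid s \mid \overline b)\ \mathsf{in}\ r$ - [R3] $\mathsf{let}\ \overline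 x \downarrow (\mathsf{putL}(v,t) \mid \overline a)\ \mathsf{in}\ r \to \mathsf{putL}(v,\mathsf{let}\ \overline x \downarrow (t \mid \overline a)\ \mathsf{in}\ r)$ - [R4] $\mathsf{let}\ \overline x \downarrow (\mathsf{getL}(y.t) \mid \overline a)\ \mathsf{in}\ r \to \mathsf{getL}(y.\mathsf{let}\ \overline x \downarrow (t \mid \overline a)\ \mathsf{in}\ r)$ - [R5] $\mathsf{let}\ \overline x \downarrow (\overline a \mid \mathsf{putR}(v,t))\ \mathsf{in}\ r \to \mathsf{putR}(v,\mathsf{let}\ \overline x \downarrow (\overline a \mid t)\ \mathsf{in}\ r)$ - [R6] $\mathsf{let}\ \overline x \downarrow (\overline a \mid \mathsf{getR}(y.t))\ \mathsf{in}\ r \to \mathsf{getR}(y.\mathsf{let}\ \overline x \downarrow (\overline a \mid t)\ \mathsf{in}\ r)$ - [R7] $\mathsf{putR}(v,\mathsf{putL}(w,t)) \to \mathsf{putL}(w,\mathsf{putR}(v,t))$ - [R8] $\mathsf{putR}(v,\mathsf{getL}(x.t)) \to \mathsf{getL}(x.\mathsf{putR}(v,t))$ when $x$ does not occur in $v$ - [R9] $\mathsf{getR}(x.\mathsf{putL}(v,t)) \to \mathsf{putL}(v,\mathsf{getR}(x.t))$ when $x$ does not occur in $v$ - [R10] $\mathsf{getR}(x.\mathsf{getL}(y.t)) \to \mathsf{getL}(y.\mathsf{getR}(x.t))$ $\stackrel{*}{\leftrightarrow}$ (convertibility) is the reflexive symmetric transitive closure of $\to$. **Single-object virtual double categories.**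 A single-object virtual double category $\mathcal{V}$ consists of a set $\mathcal{V}_H$ (horizontal edges), a monoid $(\mathcal{V}_V,\cdot,I)$ (vertical edges), and for each $\Gamma \in \mathcal{V}_H^*$, $B \in \mathcal{V}_H$, $U,W \in \mathcal{V}_V$ a set $\mathcal{V}(U;\Gamma;B;W)$ of cells (left boundary $U$, top $\Gamma$, bottom $B$, right boundary $W$). A cell path from $U$ to $W$ is a sequence $(a_1,\ldots,a_n)$ of cells $a_i \in \mathcal{V}(U_{i-1};\Gamma_i;A_i;U_i)$ with $U_0=U$, $U_n=W$; for each $U$ there is an empty cell path $(\,)_U$ from $U$ to $U$. For each $b \in \mathcal{V}(P;A_1,\ldots,A_n;B;Q)$ and cell path $(a_1,\ldots,a_n)$ from $U$ to $W$ with $a_i \in \mathcal{V}(U_{i-1};\Gamma_i;A_i;U_i)$ for $1 \le i \le n$ (where $U_0=U$ and $U_n=W$) there is a composite $b \circ (a_1,\ldots,a_n) \in \mathcal{V}(UP;\Gamma_1,\ldots,\Gamma_n;B;WQ)$, and for each $A \in \mathcal{V}_H$ an identity $1_A \in \mathcal{V}(I;A;A;I)$. These must satisfy associativity, $f \circ (g_1 \circ (h_1^1,\ldots,h_1^{k_1}),\ldots,g_n\circ(h_n^1,\ldots,h_n^{k_n})) = (f \circ (g_1,\ldots,g_n)) \circ (h_1^1,\ldots,h_1^{k_1},\ldots,h_n^1,\ldots,h_n^{k_n})$ (empty paths carrying the evident labels; in particular, $f\circ(\,)_{UW} = (f\circ(\,)_W)\circ(\,)_U$ when $n=0$), and unitality,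 $f \circ (1_{A_1},\ldots,1_{A_n}) = f = 1_B \circ (f)$, whenever the composites make sense. **The data of $[\mathcal{M}]$.** Horizontal edges: the objects of $\mathcal{M}$. Vertical edge monoid: $\mathcal{M}_0^{\circ\bullet}$. Cells in $[\mathcal{M}](U;A_1,\ldots,A_n;B;W)$: terms $x_1{:}A_1,\ldots,x_n{:}A_n \Vdash a : (U,B,W)$, modulo $\stackrel{*}{\leftrightarrow}$ (and up to the names of the context variables). Identities: $1_A$ is $x{:}A \Vdash [x] : (\lambda,A,\lambda)$. Composition: $f \circ (g_1,\ldots,g_n) = \mathsf{let}\ x_1,\ldots,x_n \downarrow (g_1 \mid \cdots \mid g_n)\ \mathsf{in}\ f$ for $n \ge 1$, and $f \circ (\,)_U = id_U(f)$, where for $f$ with empty context $id_U(f)$ is defined by recursion on $U$: $id_\lambda(f)=f$, $id_{A^\circ U'}(f) = \mathsf{getL}(x.\mathsf{putR}(x,id_{U'}(f)))$, $id_{A^\bullet U'}(f) = \mathsf{getR}(x.\mathsf{putL}(x,id_{U'}(f)))$. *)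

(* Defs.v *)
From Stdlib Require Import Relations.
From HB Require Import structures.
From mathcomp Require Import all_boot.
From mathcomp Require Import boolp.

Set Implicit Arguments.
Unset Strict Implicit.
Unset Printing Implicit Defensive.

Local Open Scope quotient_scope.

Record arrow (ob : Type) (hom : seq ob -> ob -> Type) : Type :=
  Arrow { dom : seq ob; cod : ob; mor : hom dom cod }.
Arguments Arrow {ob hom dom cod} mor.

(* [fam hom [:: Γ1; ..; Γn] [:: A1; ..; An]] is the type of families
   (v1, .., vn) with vi : hom Γi Ai. *)
Inductive fam (ob : Type) (hom : seq ob -> ob -> Type) :
    seq (seq ob) -> seq ob -> Type :=
| fnil : fam hom [::] [::]
| fcons Γ A Γs As : hom Γ A -> fam hom Γs As -> fam hom (Γ :: Γs) (A :: As).
Arguments fnil {ob hom}.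

Fixpoint fcat (ob : Type) (hom : seq ob -> ob -> Type) Γs As Δs Bs
    (vs : fam hom Γs As) (ws : fam hom Δs Bs) : fam hom (Γs ++ Δs) (As ++ Bs) :=
  match vs in fam _ Γs As return fam hom (Γs ++ Δs) (As ++ Bs) with
  | fnil => ws
  | fcons _ _ _ _ v vs' => fcons v (fcat vs' ws)
  end.

Fixpoint fids (ob : Type) (hom : seq ob -> ob -> Type)
    (ident : forall A, hom [:: A] A) (As : seq ob) :
    fam hom [seq [:: A] | A <- As] As :=
  match As with
  | [::] => fnil
  | A :: As' => fcons (ident A) (fids ident As')
  end.

(* Families of composable pairs (g_i, (h_i^1, .., h_i^{k_i})), and the three
   families occurring in the associativity law: the g_i, all the h_i^j in
   order, and the g_i o (h_i^1, .., h_i^{k_i}). *)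
Inductive fam2 (ob : Type) (hom : seq ob -> ob -> Type) :
    seq (seq (seq ob)) -> seq (seq ob) -> seq ob -> Type :=
| f2nil : fam2 hom [::] [::] [::]
| f2cons Ξs Γ A Ξss Γs As : hom Γ A -> fam hom Ξs Γ -> fam2 hom Ξss Γs As ->
    fam2 hom (Ξs :: Ξss) (Γ :: Γs) (A :: As).

Fixpoint fouter (ob : Type) (hom : seq ob -> ob -> Type) Ξss Γs As
    (n : fam2 hom Ξss Γs As) : fam hom Γs As :=
  match n in fam2 _ _ Γs As return fam hom Γs As with
  | f2nil => fnil
  | f2cons _ _ _ _ _ _ g _ n' => fcons g (fouter n')
  end.

Fixpoint finner (ob : Type) (hom : seq ob -> ob -> Type) Ξss Γs As
    (n : fam2 hom Ξss Γs As) : fam hom (flatten Ξss) (flatten Γs) :=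
  match n in fam2 _ Ξss Γs _ return fam hom (flatten Ξss) (flatten Γs) with
  | f2nil => fnil
  | f2cons _ _ _ _ _ _ _ hs n' => fcat hs (finner n')
  end.

Fixpoint fcomposites (ob : Type) (hom : seq ob -> ob -> Type)
    (mcomp : forall Γs As B, hom As B -> fam hom Γs As -> hom (flatten Γs) B)
    Ξss Γs As (n : fam2 hom Ξss Γs As) : fam hom (map flatten Ξss) As :=
  match n in fam2 _ Ξss _ As return fam hom (map flatten Ξss) As with
  | f2nil => fnil
  | f2cons _ _ _ _ _ _ g hs n' => fcons (mcomp _ _ _ g hs) (fcomposites mcomp n')
  end.

(* The two sides of each law live in hom-sets whose sources are only
   provably equal, hence the equality between packed morphisms. *)
Record multicategory : Type := Multicategory {
  ob : Type;
  hom : seq ob -> ob -> Type;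
  ident : forall A : ob, hom [:: A] A;
  mcomp : forall Γs As B, hom As B -> fam hom Γs As -> hom (flatten Γs) B;
  compA : forall Ξss Γs As B (f : hom As B) (n : fam2 hom Ξss Γs As),
    Arrow (mcomp f (fcomposites mcomp n))
    = Arrow (mcomp (mcomp f (fouter n)) (finner n));
  comp_idr : forall As B (f : hom As B), Arrow (mcomp f (fids ident As)) = Arrow f;
  comp_idl : forall As B (f : hom As B),
    Arrow (mcomp (ident B) (fcons f fnil)) = Arrow f
}.
Arguments ident {m} A.
Arguments mcomp {m Γs As B}.

(* [cpath cell U W [:: Γ1; ..; Γn] [:: A1; ..; An]] is the type of cell paths
   (a1, .., an) from U to W with ai in cell U_{i-1} Γi Ai U_i. *)
Inductive cpath (V H : Type) (cell : V -> seq H -> H -> V -> Type) :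
    V -> V -> seq (seq H) -> seq H -> Type :=
| pnil U : cpath cell U U [::] [::]
| pcons U V' W Γ A Γs As : cell U Γ A V' -> cpath cell V' W Γs As ->
    cpath cell U W (Γ :: Γs) (A :: As).
Arguments pnil {V H cell} U.

Fixpoint cpath_map (V H : Type) (c1 c2 : V -> seq H -> H -> V -> Type)
    (F : forall U Γ A W, c1 U Γ A W -> c2 U Γ A W) U W Γs As
    (p : cpath c1 U W Γs As) : cpath c2 U W Γs As :=
  match p in cpath _ U W Γs As return cpath c2 U W Γs As with
  | pnil U => pnil U
  | pcons _ _ _ _ _ _ _ a p' => pcons (F _ _ _ _ a) (cpath_map F p')
  end.

Fixpoint pcat (V H : Type) (cell : V -> seq H -> H -> V -> Type)
    T U W Γs As Δs Bs (p : cpath cell T U Γs As) :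
    cpath cell U W Δs Bs -> cpath cell T W (Γs ++ Δs) (As ++ Bs) :=
  match p in cpath _ T U Γs As
    return cpath cell U W Δs Bs -> cpath cell T W (Γs ++ Δs) (As ++ Bs) with
  | pnil _ => fun q => q
  | pcons _ _ _ _ _ _ _ a p' => fun q => pcons a (pcat p' q)
  end.

(* [cpath2 cell U U' T T' Ξss Γs As] consists of a cell path (g_1, .., g_n) from
   T to T' together with, for each i, a cell path (h_i^1, .., h_i^{k_i}) over
   the top of g_i, the latter being concatenable into a path from U to U'. *)
Inductive cpath2 (V H : Type) (cell : V -> seq H -> H -> V -> Type) :
    V -> V -> V -> V -> seq (seq (seq H)) -> seq (seq H) -> seq H -> Type :=
| p2nil U T : cpath2 cell U U T T [::] [::] [::]
| p2cons U U' U'' T T' T'' Ξs Γ A Ξss Γs As :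
    cell T Γ A T' -> cpath cell U U' Ξs Γ ->
    cpath2 cell U' U'' T' T'' Ξss Γs As ->
    cpath2 cell U U'' T T'' (Ξs :: Ξss) (Γ :: Γs) (A :: As).

Fixpoint pouter (V H : Type) (cell : V -> seq H -> H -> V -> Type)
    U U' T T' Ξss Γs As (n : cpath2 cell U U' T T' Ξss Γs As) :
    cpath cell T T' Γs As :=
  match n in cpath2 _ _ _ T T' _ Γs As return cpath cell T T' Γs As with
  | p2nil _ T => pnil T
  | p2cons _ _ _ _ _ _ _ _ _ _ _ _ g _ n' => pcons g (pouter n')
  end.

Fixpoint pinner (V H : Type) (cell : V -> seq H -> H -> V -> Type)
    U U' T T' Ξss Γs As (n : cpath2 cell U U' T T' Ξss Γs As) :
    cpath cell U U' (flatten Ξss) (flatten Γs) :=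
  match n in cpath2 _ U U' _ _ Ξss Γs _
    return cpath cell U U' (flatten Ξss) (flatten Γs) with
  | p2nil U _ => pnil U
  | p2cons _ _ _ _ _ _ _ _ _ _ _ _ _ hs n' => pcat hs (pinner n')
  end.

Record svdc_data : Type := SvdcData {
  hor : Type;
  vert : Type;
  vone : vert;
  vmul : Monoid.law vone;
  cell : vert -> seq hor -> hor -> vert -> Type;
  vid : forall A : hor, cell vone [:: A] A vone;
  vcomp : forall U W P Q Γs As B,
    cell P As B Q -> cpath cell U W Γs As ->
    cell (vmul U P) (flatten Γs) B (vmul W Q)
}.
Arguments vid {s} A.
Arguments vcomp {s U W P Q Γs As B}.

Fixpoint pcomposites (D : svdc_data) U U' T T' Ξss Γs As
    (n : cpath2 (@cell D) U U' T T' Ξss Γs As) :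
    cpath (@cell D) (vmul D U T) (vmul D U' T') (map flatten Ξss) As :=
  match n in cpath2 _ U U' T T' Ξss _ As
    return cpath (@cell D) (vmul D U T) (vmul D U' T') (map flatten Ξss) As with
  | p2nil U T => pnil (vmul D U T)
  | p2cons _ _ _ _ _ _ _ _ _ _ _ _ g hs n' =>
      pcons (vcomp g hs) (pcomposites n')
  end.

Fixpoint pids (D : svdc_data) (As : seq (hor D)) :
    cpath (@cell D) (vone D) (vone D) [seq [:: A] | A <- As] As :=
  match As with
  | [::] => pnil (vone D)
  | A :: As' => pcons (vid A) (pids As')
  end.

(* The boundaries of the two sides of each law agree only up to the monoid
   laws, hence the equality between cells packed with their boundary. *)
Record anycell (D : svdc_data) : Type := AnyCell {
  left_of : vert D; top_of : seq (hor D); bottom_of : hor D; right_of : vert D;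
  cell_of : cell left_of top_of bottom_of right_of
}.
Arguments AnyCell {D left_of top_of bottom_of right_of} cell_of.

Record is_svdc (D : svdc_data) : Prop := IsSvdc {
  vcompA : forall U U' T T' P Q Ξss Γs As (B : hor D)
      (f : cell P As B Q) (n : cpath2 (@cell D) U U' T T' Ξss Γs As),
    AnyCell (vcomp f (pcomposites n))
    = AnyCell (vcomp (vcomp f (pouter n)) (pinner n));
  vcomp_idr : forall P Q As (B : hor D) (f : cell P As B Q),
    AnyCell (vcomp f (pids As)) = AnyCell f;
  vcomp_idl : forall P Q As (B : hor D) (f : cell P As B Q),
    AnyCell (vcomp (vid B) (pcons f (pnil Q))) = AnyCell f
}.

Inductive polarity := circ | bullet.

Section Terms.
Variable M : multicategory.

Local Notation arr := (arrow (@hom M)).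

Definition word := seq (ob M * polarity).

(* Contexts are ordered and every variable is used exactly once, in order, so
   a variable is determined by its position and terms carry no names. A raw
   term has a definite context (see [ctx]); its i-th element is the i-th free
   variable. [GetL A t] binds the first variable of [t], of type A, [GetR A t]
   binds the last one, and [Let ts t] binds all the variables of [t]. *)
Inductive raw : Type :=
| Seq (v : arr)
| Let (ts : seq raw) (t : raw)
| PutR (v : arr) (t : raw)
| GetL (A : ob M) (t : raw)
| GetR (A : ob M) (t : raw)
| PutL (v : arr) (t : raw).

Fixpoint ctx (t : raw) : seq (ob M) :=
  match t with
  | Seq v => dom v
  | Let ts _ => flatten (map ctx ts)
  | PutR v t => ctx t ++ dom v
  | GetL _ t => behead (ctx t)
  | GetR _ t => take (size (ctx t)).-1 (ctx t)
  | PutL v t => dom v ++ ctx t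
  end.

(* [typed Γ t U B W] is the judgement that t has type (U, B, W) in context Γ;
   [typeds Γs ts U As W] says that t_i has type (U_{i-1}, A_i, U_i) in context
   Γ_i for 1 <= i <= n, with U_0 = U and U_n = W. *)
Inductive typed : seq (ob M) -> raw -> word -> ob M -> word -> Prop :=
| T_seq Γ A (v : hom Γ A) : typed Γ (Seq (Arrow v)) [::] A [::]
| T_let Γs As ts t U W V B Q :
    0 < size As -> typeds Γs ts U As W -> typed As t V B Q ->
    typed (flatten Γs) (Let ts t) (U ++ V) B (W ++ Q)
| T_putR Δ Γ A (v : hom Γ A) t U B W : typed Δ t U B W ->
    typed (Δ ++ Γ) (PutR (Arrow v) t) U B ((A, circ) :: W)
| T_getL Γ A t U B W : typed (A :: Γ) t U B W ->
    typed Γ (GetL A t) ((A, circ) :: U) B W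
| T_getR Γ A t U B W : typed (Γ ++ [:: A]) t U B W ->
    typed Γ (GetR A t) U B ((A, bullet) :: W)
| T_putL Γ Δ A (v : hom Γ A) t U B W : typed Δ t U B W ->
    typed (Γ ++ Δ) (PutL (Arrow v) t) ((A, bullet) :: U) B W
with typeds : seq (seq (ob M)) -> seq raw -> word -> seq (ob M) -> word -> Prop :=
| T_nil U : typeds [::] [::] U [::] U
| T_cons Γ A Γs As t ts U V W : typed Γ t U A V -> typeds Γs ts V As W ->
    typeds (Γ :: Γs) (t :: ts) U (A :: As) W.

Fixpoint fam_of (vs : seq arr) : fam (@hom M) (map (@dom _ _) vs) (map (@cod _ _) vs) :=
  match vs with
  | [::] => fnil
  | v :: vs' => fcons (mor v) (fam_of vs')
  end.

(* u[v1, .., vn / x1, .., xn]; the second branch, for lists that do not match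
   the source of u, is never reached from typed terms. *)
Definition vsubst (u : arr) (vs : seq arr) : arr :=
  match pselect (map (@cod _ _) vs = dom u) with
  | left e => Arrow (mcomp (mor u) (eq_rect _ (fam (@hom M) _) (fam_of vs) _ e))
  | right _ => u
  end.

Definition idarr (A : ob M) : arr := Arrow (ident A).

(* Simultaneous substitution of [vs] for the variables of [t], in order. *)
Fixpoint subst (t : raw) (vs : seq arr) {struct t} : raw :=
  match t with
  | Seq u => Seq (vsubst u vs)
  | Let ts s =>
      Let ((fix substs (ts : seq raw) (vs : seq arr) {struct ts} : seq raw :=
              match ts with
              | [::] => [::]
              | t :: ts' => subst t (take (size (ctx t)) vs)
                            :: substs ts' (drop (size (ctx t)) vs)
              end) ts vs) s
  | PutR u s => PutR (vsubst u (drop (size (ctx s)) vs))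
                     (subst s (take (size (ctx s)) vs))
  | GetL A s => GetL A (subst s (idarr A :: vs))
  | GetR A s => GetR A (subst s (rcons vs (idarr A)))
  | PutL u s => PutL (vsubst u (take (size (dom u)) vs))
                     (subst s (drop (size (dom u)) vs))
  end.

(* The proviso of R8 is automatic here, the variable bound by [GetL] not being
   in scope in v. In R9 the bound variable is the last one of [PutL v t]; it
   does not occur in v iff it belongs to t, i.e. iff t has a last variable. *)
Inductive step : raw -> raw -> Prop :=
| R0 vs t : step (Let (map Seq vs) t) (subst t vs)
| R1 ts us v t A s r Γ : ctx s = A :: Γ ->
    step (Let (ts ++ PutR v t :: GetL A s :: us) r)
         (Let (ts ++ t :: subst s (v :: map idarr Γ) :: us) r)
| R2 ts us v t A s r Γ : ctx t = Γ ++ [:: A] ->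
    step (Let (ts ++ GetR A t :: PutL v s :: us) r)
         (Let (ts ++ subst t (map idarr Γ ++ [:: v]) :: s :: us) r)
| R3 us v t r : step (Let (PutL v t :: us) r) (PutL v (Let (t :: us) r))
| R4 us A t r : step (Let (GetL A t :: us) r) (GetL A (Let (t :: us) r))
| R5 ts v t r :
    step (Let (ts ++ [:: PutR v t]) r) (PutR v (Let (ts ++ [:: t]) r))
| R6 ts A t r :
    step (Let (ts ++ [:: GetR A t]) r) (GetR A (Let (ts ++ [:: t]) r))
| R7 v w t : step (PutR v (PutL w t)) (PutL w (PutR v t))
| R8 v A t : step (PutR v (GetL A t)) (GetL A (PutR v t))
| R9 v A t Γ : ctx t = Γ ++ [:: A] ->
    step (GetR A (PutL v t)) (PutL v (GetR A t))
| R10 A A' t : step (GetR A (GetL A' t)) (GetL A' (GetR A t))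
| C_let1 ts us t t' r : step t t' ->
    step (Let (ts ++ t :: us) r) (Let (ts ++ t' :: us) r)
| C_let2 ts r r' : step r r' -> step (Let ts r) (Let ts r')
| C_putR v t t' : step t t' -> step (PutR v t) (PutR v t')
| C_getL A t t' : step t t' -> step (GetL A t) (GetL A t')
| C_getR A t t' : step t t' -> step (GetR A t) (GetR A t')
| C_putL v t t' : step t t' -> step (PutL v t) (PutL v t').

Definition term (U : word) (Γ : seq (ob M)) (B : ob M) (W : word) : Type :=
  {t : raw | typed Γ t U B W}.

(* A raw term has at most one type and [step] preserves it, so chains between
   terms of a fixed type are all chains of typed terms. *)
Definition conv U Γ B W : relation (term U Γ B W) :=
  clos_refl_sym_trans _ (fun s t => step (sval s) (sval t)).

Definition convb U Γ B W : rel {classic term U Γ B W} := fun s t => `[< conv s t >].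

Lemma convb_equiv U Γ B W : equiv_class_of (@convb U Γ B W).
Proof.
split.
- by move=> t; apply/asboolP; apply: rst_refl.
- by move=> s t; apply/asboolP/asboolP; apply: rst_sym.
- by move=> s t u /asboolP st /asboolP tu; apply/asboolP; apply: rst_trans tu.
Qed.

Canonical convb_equiv_rel U Γ B W := EquivRelPack (@convb_equiv U Γ B W).

Definition term_class U Γ B W : Type := {eq_quot (@convb_equiv_rel U Γ B W)}.

Definition class_of U Γ B W (t : term U Γ B W) : term_class U Γ B W :=
  \pi_{eq_quot (@convb_equiv_rel U Γ B W)} t.

Definition rep U Γ B W (c : term_class U Γ B W) : term U Γ B W := repr c.

Definition tid (A : ob M) : term [::] [:: A] A [::] :=
  exist _ (Seq (idarr A)) (T_seq (ident A)).

Fixpoint idU_raw (U : word) (t : raw) : raw :=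
  match U with
  | [::] => t
  | (A, circ) :: U' => GetL A (PutR (idarr A) (idU_raw U' t))
  | (A, bullet) :: U' => GetR A (PutL (idarr A) (idU_raw U' t))
  end.

Lemma idU_typed U P B Q t :
  typed [::] t P B Q -> typed [::] (idU_raw U t) (U ++ P) B (U ++ Q).
Proof.
move=> ht; elim: U => [//|[A []] U IH] /=.
- by apply: T_getL; apply: (@T_putR [::]).
- by apply: T_getR; apply: (@T_putL [:: A] [::]).
Qed.

Fixpoint raws U W Γs As (p : cpath term U W Γs As) : seq raw :=
  match p with
  | pnil _ => [::]
  | pcons _ _ _ _ _ _ _ a p' => sval a :: raws p'
  end.

Lemma raws_typed U W Γs As (p : cpath term U W Γs As) :
  typeds Γs (raws p) U As W.
Proof.
elim: p => [V|V V' X Γ A Δs Bs a p IH] /=; first exact: T_nil.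
exact: T_cons (svalP a) IH.
Qed.

Definition tlet U W Γ Γs A As P B Q (f : term P (A :: As) B Q)
    (p : cpath term U W (Γ :: Γs) (A :: As)) :
    term (U ++ P) (flatten (Γ :: Γs)) B (W ++ Q) :=
  exist _ (Let (raws p) (sval f))
    (T_let (As := A :: As) isT (raws_typed p) (svalP f)).

Definition tidU U P B Q (f : term P [::] B Q) :
    term (U ++ P) [::] B (U ++ Q) :=
  exist _ (idU_raw U (sval f)) (idU_typed U (svalP f)).

Definition tcomp U W P Q Γs As B (f : term P As B Q)
    (p : cpath term U W Γs As) : term (U ++ P) (flatten Γs) B (W ++ Q) :=
  match p in cpath _ U W Γs As
    return term P As B Q -> term (U ++ P) (flatten Γs) B (W ++ Q) with
  | pnil U => fun f => tidU U f
  | pcons _ _ _ _ _ _ _ a p' => fun f => tlet f (pcons a p')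
  end f.

Definition class_comp U W P Q Γs As B (f : term_class P As B Q)
    (p : cpath term_class U W Γs As) : term_class (U ++ P) (flatten Γs) B (W ++ Q) :=
  class_of (tcomp (rep f) (cpath_map rep p)).

Definition bracket : svdc_data :=
  @SvdcData (ob M) word [::] (@cat (ob M * polarity)) term_class
    (fun A => class_of (tid A)) class_comp.

End Terms.

(* Main.v *)
(** Everything is derived from forward reductions of raw terms: two terms of the
    same type with a common reduct are convertible, by subject reduction.

    Call a term let-free if it contains no [Let].  In a composable path of
    let-free terms, either all terms are values [v], or the first one starts
    with a left operation, or the last one with a right operation, or two
    adjacent ones are ready for R1 or R2.  Hence every [Let] can be eliminated,
    and the left unit law follows by induction on the let-free form of f.

    For associativity, make the innermost path h let-free and induct on its
    number of operations.  Each move of h - emitting an operation on the left or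
    on the right, or communicating internally - is simulated on both sides of
    the law, whatever f and g are.  The only delicate point is a factor
    g_i o ( )_U with no h's: it is an identity wire, which relays the messages
    of its neighbours.  When h has become a path of values, both sides reduce to
    the same substitution instance. *)
Require Import Defs.
From mathcomp Require Import all_boot.
From Stdlib Require Import Relations.
From mathcomp Require Import boolp.

Set Implicit Arguments.
Unset Strict Implicit.
Unset Printing Implicit Defensive.

Scheme typed_mind := Minimality for typed Sort Prop
  with typeds_mind := Minimality for typeds Sort Prop.
Combined Scheme typed_typeds_ind from typed_mind, typeds_mind.

(** * Typing: inversion, contexts, preservation under value substitution *)

Section Typing.
Variable M : multicategory.
Local Notation arr := (arrow (@hom M)).
Implicit Types (Γ Δ As : seq (ob M)) (U V W P Q : word M) (A B : ob M).
Implicit Types (t s r f g : raw M) (ts us hs : seq (raw M)) (v : arr) (vs : seq arr).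

Definition doms vs : seq (ob M) := flatten (map (@dom _ _) vs).
Definition cods vs : seq (ob M) := map (@cod _ _) vs.

Lemma doms_cat vs ws : doms (vs ++ ws) = doms vs ++ doms ws.
Proof. by rewrite /doms map_cat flatten_cat. Qed.

Lemma doms_cons v vs : doms (v :: vs) = dom v ++ doms vs. Proof. by []. Qed.

Lemma cods_cat vs ws : cods (vs ++ ws) = cods vs ++ cods ws.
Proof. exact: map_cat. Qed.

Lemma cods_cons v vs : cods (v :: vs) = cod v :: cods vs. Proof. by []. Qed.

(** The indices of [typed] contain concatenations such as [U ++ V], so inversion is given as
    explicit equations, selected by a [match] on the term. *)
Lemma typedE Γ t U B W : typed Γ t U B W ->
  match t with
  | Seq v => [/\ Γ = dom v, B = cod v, U = [::] & W = [::]]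
  | Let ts s => exists Γs As U' V W' Q,
      [/\ Γ = flatten Γs, U = U' ++ V, W = W' ++ Q &
          [/\ 0 < size As, typeds Γs ts U' As W' & typed As s V B Q]]
  | PutR v s => exists Δ W',
      [/\ Γ = Δ ++ dom v, W = (cod v, circ) :: W' & typed Δ s U B W']
  | GetL A s => exists2 U', U = (A, circ) :: U' & typed (A :: Γ) s U' B W
  | GetR A s => exists2 W', W = (A, bullet) :: W' & typed (Γ ++ [:: A]) s U B W'
  | PutL v s => exists Δ U',
      [/\ Γ = dom v ++ Δ, U = (cod v, bullet) :: U' & typed Δ s U' B W]
  end.
Proof.
case=> {Γ t U B W}.
- by [].
- by move=> Γs As ts t U W V B Q ? ? ?; exists Γs, As, U, V, W, Q.
- by move=> Δ Γ A v t U B W ?; exists Δ, W.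
- by move=> Γ A t U B W ?; exists U.
- by move=> Γ A t U B W ?; exists W.
- by move=> Γ Δ A v t U B W ?; exists Δ, U.
Qed.

Lemma typedsE Γs ts U As W : typeds Γs ts U As W ->
  match ts with
  | [::] => [/\ Γs = [::], As = [::] & U = W]
  | t :: ts' => exists Γ A Γs' As' V,
      [/\ Γs = Γ :: Γs', As = A :: As', typed Γ t U A V &
          typeds Γs' ts' V As' W]
  end.
Proof.
case=> {Γs ts U As W} // Γ A Γs As t ts U V W ? ?.
by exists Γ, A, Γs, As, V.
Qed.

Lemma T_seq' v : typed (dom v) (Seq v) [::] (cod v) [::].
Proof. by case: v => Γ A v; apply: T_seq. Qed.

Lemma T_putR' Δ v t U B W : typed Δ t U B W ->
  typed (Δ ++ dom v) (PutR v t) U B ((cod v, circ) :: W).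
Proof. by case: v => Γ A v; apply: T_putR. Qed.

Lemma T_putL' Δ v t U B W : typed Δ t U B W ->
  typed (dom v ++ Δ) (PutL v t) ((cod v, bullet) :: U) B W.
Proof. by case: v => Γ A v; apply: T_putL. Qed.

Lemma typeds_cat Γs ts U As V Δs us Bs W :
  typeds Γs ts U As V -> typeds Δs us V Bs W ->
  typeds (Γs ++ Δs) (ts ++ us) U (As ++ Bs) W.
Proof.
elim: ts Γs U As => [|t ts IH] Γs U As.
  by move=> /typedsE[-> -> ->].
move=> /typedsE[Γ [A [Γs' [As' [X [-> -> tt tts]]]]]] tus.
exact: T_cons tt (IH _ _ _ tts tus).
Qed.

Lemma typeds_catE Γs ts us U As W : typeds Γs (ts ++ us) U As W ->
  exists Γs1 Γs2 As1 As2 V,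
    [/\ Γs = Γs1 ++ Γs2, As = As1 ++ As2, typeds Γs1 ts U As1 V &
        typeds Γs2 us V As2 W].
Proof.
elim: ts Γs U As => [|t ts IH] Γs U As /=.
  by move=> tus; exists [::], Γs, [::], As, U; split => //; apply: T_nil.
move=> /typedsE[Γ [A [Γs' [As' [X [-> -> tt]]]]]].
move=> /IH[Γs1 [Γs2 [As1 [As2 [V [-> -> tts tus]]]]]].
by exists (Γ :: Γs1), Γs2, (A :: As1), As2, V; split => //; apply: T_cons tts.
Qed.

Lemma typed_ctx_mutual :
  (forall Γ t U B W, typed Γ t U B W -> ctx t = Γ) /\
  (forall Γs ts U As W, typeds Γs ts U As W -> map (@ctx M) ts = Γs).
Proof.
apply: typed_typeds_ind => //=.
- by move=> Γs As ts t U W V B Q _ _ ->.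
- by move=> Δ Γ A v t U B W _ ->.
- by move=> Γ A t U B W _ ->.
- by move=> Γ A t U B W _ ->; rewrite size_cat addn1 take_size_cat.
- by move=> Γ Δ A v t U B W _ ->.
- by move=> Γ A Γs As t ts U V W _ -> _ ->.
Qed.

Lemma typed_ctx Γ t U B W : typed Γ t U B W -> ctx t = Γ.
Proof. exact: typed_ctx_mutual.1. Qed.

Lemma typeds_ctx Γs ts U As W : typeds Γs ts U As W -> map (@ctx M) ts = Γs.
Proof. exact: typed_ctx_mutual.2. Qed.

(** A name for the fixpoint nested inside [subst]; the two are convertible, so [subst_let] holds by
    computation. *)
Definition substs := fix substs ts vs {struct ts} : seq (raw M) :=
  match ts with
  | [::] => [::]
  | t :: ts' => subst t (take (size (ctx t)) vs)
                :: substs ts' (drop (size (ctx t)) vs)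
  end.

Lemma subst_let ts s vs : subst (Let ts s) vs = Let (substs ts vs) s.
Proof. by []. Qed.

Lemma vsubst_dom u vs : cods vs = dom u -> dom (vsubst u vs) = doms vs.
Proof. by rewrite /vsubst => e; case: pselect. Qed.

Lemma vsubst_cod u vs : cod (vsubst u vs) = cod u.
Proof. by rewrite /vsubst; case: pselect. Qed.

Lemma cods_ids As : cods (map (@idarr M) As) = As.
Proof. by rewrite /cods; elim: As => //= A As ->. Qed.

Lemma doms_ids As : doms (map (@idarr M) As) = As.
Proof. by rewrite /doms; elim: As => //= A As ->. Qed.

Lemma cods_take n vs Γ Δ : cods vs = Γ ++ Δ -> n = size Γ ->
  cods (take n vs) = Γ /\ cods (drop n vs) = Δ.
Proof.
move=> e ->; rewrite /cods map_take map_drop.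
by rewrite [map _ _]e take_size_cat // drop_size_cat.
Qed.

(** In a path only the concatenation of the new contexts is prescribed, since [vs] is cut up term by
    term; hence the existential [Δs]. *)
Lemma typed_subst_mutual :
  (forall Γ t U B W, typed Γ t U B W -> forall vs, cods vs = Γ ->
     typed (doms vs) (subst t vs) U B W) /\
  (forall Γs ts U As W, typeds Γs ts U As W -> forall vs, cods vs = flatten Γs ->
     exists2 Δs, flatten Δs = doms vs & typeds Δs (substs ts vs) U As W).
Proof.
apply: typed_typeds_ind.
- move=> Γ A v vs e /=; have := T_seq' (vsubst (Arrow v) vs).
  by rewrite vsubst_dom // vsubst_cod.
- move=> Γs As ts t U W V B Q As0 _ IHts tt _ vs e.
  have [Δs <- tts] := IHts _ e.
  by rewrite subst_let; apply: T_let tt.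
- move=> Δ Γ A v t U B W tt IH vs e /=.
  rewrite (typed_ctx tt).
  have [e1 e2] := cods_take e (erefl (size Δ)).
  rewrite -[in doms vs](cat_take_drop (size Δ) vs) doms_cat.
  have := T_putR' (vsubst (Arrow v) (drop (size Δ) vs)) (IH _ e1).
  by rewrite vsubst_dom // vsubst_cod.
- move=> Γ A t U B W tt IH vs e /=; apply: T_getL.
  by apply: (IH (idarr A :: vs)); rewrite /= -e.
- move=> Γ A t U B W tt IH vs e /=; apply: T_getR.
  have <- : doms (rcons vs (idarr A)) = doms vs ++ [:: A].
    by rewrite -cats1 doms_cat.
  by apply: IH; rewrite /cods map_rcons [map _ _]e cats1.
- move=> Γ Δ A v t U B W tt IH vs e /=.
  have [e1 e2] := cods_take e (erefl (size Γ)).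
  rewrite -[in doms vs](cat_take_drop (size Γ) vs) doms_cat.
  have := T_putL' (vsubst (Arrow v) (take (size Γ) vs)) (IH _ e2).
  by rewrite vsubst_dom // vsubst_cod.
- move=> U [|//] _; exists [::] => //=; exact: T_nil.
- move=> Γ A Γs As t ts U V W tt IHt tts IHts vs /= e.
  rewrite (typed_ctx tt).
  have [e1 e2] := cods_take e (erefl (size Γ)).
  have [Δs eΔ tts'] := IHts _ e2.
  exists (doms (take (size Γ) vs) :: Δs).
    by rewrite /= eΔ -doms_cat cat_take_drop.
  exact: T_cons (IHt _ e1) tts'.
Qed.

Lemma typed_subst t vs U B W :
  typed (cods vs) t U B W -> typed (doms vs) (subst t vs) U B W.
Proof. by move=> tt; apply: (typed_subst_mutual.1 _ _ _ _ _ tt). Qed.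

(** Families packed with their indices, so that two families whose index lists are only provably
    equal can be equated. *)
Definition anyfam : Type :=
  {p : seq (seq (ob M)) * seq (ob M) & fam (@hom M) p.1 p.2}.

Lemma fam_of_ids As :
  existT _ (_, _) (fam_of (map (@idarr M) As)) =
  existT _ (_, _) (fids (@ident M) As) :> anyfam.
Proof.
elim: As => //= A As IH.
pose F (q : anyfam) : anyfam :=
  existT _ ([:: A] :: (projT1 q).1, A :: (projT1 q).2)
    (fcons (ident A) (projT2 q)).
exact: (congr1 F IH).
Qed.

Lemma vsubst_ids u : vsubst u (map (@idarr M) (dom u)) = u.
Proof.
rewrite /vsubst; case: pselect => [e|//].
(* [G] abstracts over the packed family and over the proof used in the cast; the family can then be
   rewritten, and the remaining cast is trivial. *)
pose G (q : anyfam) : Prop := forall e' : (projT1 q).2 = dom u,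
  Arrow (mcomp (mor u) (eq_rect _ (fam (@hom M) _) (projT2 q) _ e')) = u.
suff : G (existT _ (_, _) (fam_of (map (@idarr M) (dom u)))) by exact.
rewrite fam_of_ids => /= e'; rewrite (Prop_irrelevance e' erefl) /=.
by rewrite comp_idr; case: u {e e' G}.
Qed.

Lemma vsubst_idarr v : vsubst (idarr (cod v)) [:: v] = v.
Proof.
rewrite /vsubst; case: pselect => [e|//]; rewrite (Prop_irrelevance e erefl) /=.
by rewrite comp_idl; case: v {e}.
Qed.

Lemma take_ids Γ Δ :
  take (size Γ) (map (@idarr M) (Γ ++ Δ)) = map (@idarr M) Γ.
Proof. by rewrite -map_take take_size_cat. Qed.

Lemma drop_ids Γ Δ :
  drop (size Γ) (map (@idarr M) (Γ ++ Δ)) = map (@idarr M) Δ.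
Proof. by rewrite -map_drop drop_size_cat. Qed.

Lemma subst_ids_mutual :
  (forall Γ t U B W, typed Γ t U B W -> subst t (map (@idarr M) Γ) = t) /\
  (forall Γs ts U As W, typeds Γs ts U As W ->
     substs ts (map (@idarr M) (flatten Γs)) = ts).
Proof.
apply: typed_typeds_ind.
- by move=> Γ A v /=; rewrite (vsubst_ids (Arrow v)).
- by move=> Γs As ts t U W V B Q _ _ IH _ _; rewrite subst_let IH.
- move=> Δ Γ A v t U B W tt IH /=.
  by rewrite (typed_ctx tt) take_ids drop_ids IH (vsubst_ids (Arrow v)).
- by move=> Γ A t U B W tt IH /=; rewrite [subst _ _]IH.
- by move=> Γ A t U B W tt IH /=; rewrite -map_rcons -cats1 IH.
- move=> Γ Δ A v t U B W tt IH /=.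
  by rewrite take_ids drop_ids IH (vsubst_ids (Arrow v)).
- by [].
- move=> Γ A Γs As t ts U V W tt IH tts IHs /=.
  by rewrite (typed_ctx tt) take_ids drop_ids IH IHs.
Qed.

Lemma subst_ids Γ t U B W : typed Γ t U B W -> subst t (map (@idarr M) Γ) = t.
Proof. exact: subst_ids_mutual.1. Qed.

Lemma substs_ids Γs ts U As W : typeds Γs ts U As W ->
  substs ts (map (@idarr M) (flatten Γs)) = ts.
Proof. exact: subst_ids_mutual.2. Qed.

End Typing.

(** * Operations, communications across a boundary, subject reduction *)

Section Reduction.
Variable M : multicategory.
Local Notation arr := (arrow (@hom M)).
Implicit Types (Γ Δ As : seq (ob M)) (U V W P Q : word M) (A B : ob M).
Implicit Types (t s r f g x y : raw M) (ts us hs : seq (raw M)).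
Implicit Types (v : arr) (vs : seq arr) (p : ob M * polarity) (o : arr + ob M).

(** One notation for the operations on either side: [inl v] sends the value [v], [inr A] receives a
    value of type [A]. The labels [llab] and [rlab] are the letters these add to the boundary, so R3
    to R6 become two rules. *)
Definition lop o t := match o with inl v => PutL v t | inr A => GetL A t end.
Definition rop o t := match o with inl v => PutR v t | inr A => GetR A t end.
Definition llab o : ob M * polarity :=
  match o with inl v => (cod v, bullet) | inr A => (A, circ) end.
Definition rlab o : ob M * polarity :=
  match o with inl v => (cod v, circ) | inr A => (A, bullet) end.

Lemma typed_lop Γ o t U B W : typed Γ (lop o t) U B W ->
  exists Γ' U', U = llab o :: U' /\ typed Γ' t U' B W.
Proof.
case: o => [v|A] /typedE.
  by move=> [Δ [U' [_ -> ?]]]; exists Δ, U'.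
by move=> [U' -> ?]; exists (A :: Γ), U'.
Qed.

Lemma typed_rop Γ o t U B W : typed Γ (rop o t) U B W ->
  exists Γ' W', W = rlab o :: W' /\ typed Γ' t U B W'.
Proof.
case: o => [v|A] /typedE.
  by move=> [Δ [U' [_ -> ?]]]; exists Δ, U'.
by move=> [U' -> ?]; exists (Γ ++ [:: A]), U'.
Qed.

(* The communications of R1 and R2 across a boundary letter p. *)
Inductive comm : ob M * polarity -> raw M -> raw M -> raw M -> raw M -> Prop :=
| CommR v t s Γ : ctx s = cod v :: Γ ->
    comm (cod v, circ) (PutR v t) (GetL (cod v) s)
      t (subst s (v :: map (@idarr M) Γ))
| CommL v t s Γ : ctx t = Γ ++ [:: cod v] ->
    comm (cod v, bullet) (GetR (cod v) t) (PutL v s)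
      (subst t (map (@idarr M) Γ ++ [:: v])) s.

(** The letter [p] is consumed, and the context of the message moves from one term to its neighbour.
    It sits exactly at their border, so the concatenated context is unchanged. *)
Lemma comm_typed p x y x' y' Γ Δ U V W A B : comm p x y x' y' ->
  typed Γ x U A V -> typed Δ y V B W ->
  exists Γ' Δ' V', [/\ V = p :: V', Γ' ++ Δ' = Γ ++ Δ, typed Γ' x' U A V' &
                       typed Δ' y' V' B W].
Proof.
case=> v t s Θ e.
  move=> /typedE[Γ' [V' [-> -> tt]]] /typedE[V'' [e''] ts].
  exists Γ', (dom v ++ Δ), V'; split => //; first by rewrite catA.
  rewrite {}e''; move: e; rewrite (typed_ctx ts) => -[?]; subst Θ.
  have := @typed_subst _ s (v :: map (@idarr M) Δ).
  by rewrite cods_cons doms_cons cods_ids doms_ids; apply.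
move=> /typedE[V' -> tt] /typedE[Δ' [V'' [-> [<-] ts]]].
exists (Γ ++ dom v), Δ', V'; split => //; first by rewrite catA.
move: e; rewrite (typed_ctx tt) !cats1 => /rcons_inj[?]; subst Θ.
have := @typed_subst _ t (map (@idarr M) Γ ++ [:: v]).
by rewrite cods_cat doms_cat doms_cons cods_ids doms_ids cats0 -cats1; apply.
Qed.

(** R1 and R2 as moves of the path alone, so that the same move can be replayed in every [Let] over
    that path. *)
Inductive cut : seq (raw M) -> seq (raw M) -> Prop :=
| Cut ts p x y x' y' us : comm p x y x' y' ->
    cut (ts ++ x :: y :: us) (ts ++ x' :: y' :: us).

Lemma cut_cat ts us hs hs' : cut hs hs' -> cut (ts ++ hs ++ us) (ts ++ hs' ++ us).
Proof.
by case=> ts' p x y x' y' us' c; rewrite -!catA !(catA ts) /=; apply: Cut c.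
Qed.

Lemma cut_typeds ts ts' Γs U As W : cut ts ts' -> typeds Γs ts U As W ->
  exists2 Γs', flatten Γs' = flatten Γs & typeds Γs' ts' U As W.
Proof.
case=> hs p x y x' y' us c /typeds_catE[Γs1 [Γs2 [As1 [As2 [V [-> -> ths]]]]]].
move=> /typedsE[Γ [A [Γs' [As' [X [-> -> tx]]]]]].
move=> /typedsE[Δ [B [Δs' [Bs' [Y [-> -> ty tus]]]]]].
have [Γ' [Δ' [X' [_ e tx' ty']]]] := comm_typed c tx ty.
exists (Γs1 ++ Γ' :: Δ' :: Δs').
  by rewrite !flatten_cat /= (catA Γ') e -catA.
apply: typeds_cat ths _; apply: T_cons tx' _; exact: T_cons ty' _.
Qed.

Lemma step_comm ts us r p x y x' y' : comm p x y x' y' ->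
  step (Let (ts ++ x :: y :: us) r) (Let (ts ++ x' :: y' :: us) r).
Proof. by case=> v t s Γ e; [apply: R1|apply: R2]. Qed.

Lemma step_cut ts ts' r : cut ts ts' -> step (Let ts r) (Let ts' r).
Proof. by case=> hs p x y x' y' us c; apply: step_comm c. Qed.

Lemma step_lop o t us r : step (Let (lop o t :: us) r) (lop o (Let (t :: us) r)).
Proof. by case: o => ?; [apply: R3|apply: R4]. Qed.

Lemma step_rop ts o t r :
  step (Let (ts ++ [:: rop o t]) r) (rop o (Let (ts ++ [:: t]) r)).
Proof. by case: o => ?; [apply: R5|apply: R6]. Qed.

(** Values have empty boundaries, but an empty path may sit at any word [U]; this exception is the
    source of the identity wires. *)
Lemma typeds_Seq vs Γs U As W : typeds Γs (map (@Seq M) vs) U As W ->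
  [/\ Γs = map (@dom _ _) vs, As = cods vs, U = W & vs <> [::] -> U = [::]].
Proof.
elim: vs Γs U As => [|v vs IH] Γs U As /=.
  by move=> /typedsE[-> -> ->].
move=> /typedsE[Γ [A [Γs' [As' [V [-> ->]]]]]].
move=> /typedE[-> -> -> ->] /IH[-> -> e h]; split => //.
Qed.

Lemma typed_let_inv ts r Γ U B W : typed Γ (Let ts r) U B W ->
  exists Γs As U' V W' Q, [/\ Γ = flatten Γs, U = U' ++ V, W = W' ++ Q &
    [/\ 0 < size As, typeds Γs ts U' As W' & typed As r V B Q]].
Proof. exact: typedE. Qed.

Lemma typed_cut ts ts' r Γ U B W : cut ts ts' ->
  typed Γ (Let ts r) U B W -> typed Γ (Let ts' r) U B W.
Proof.
move=> c /typed_let_inv[Γs [As [U' [V [W' [Q [-> -> -> [As0 tts tr]]]]]]]].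
by have [Γs' <- tts'] := cut_typeds c tts; apply: T_let tr.
Qed.

Lemma typeds_pair Γs ts x y us U As W : typeds Γs (ts ++ x :: y :: us) U As W ->
  exists Γ Δ X A V B Y, typed Γ x X A V /\ typed Δ y V B Y.
Proof.
move=> /typeds_catE[Γs1 [Γs2 [As1 [As2 [X [_ _ _]]]]]].
move=> /typedsE[Γ [A [Γs' [As' [V [_ _ tx]]]]]].
move=> /typedsE[Δ [B [Δs' [Bs' [Y [_ _ ty _]]]]]].
by exists Γ, Δ, X, A, V, B, Y.
Qed.

Lemma subject_reduction t t' : step t t' ->
  forall Γ U B W, typed Γ t U B W -> typed Γ t' U B W.
Proof.
elim=> {t t'}.
- move=> vs t Γ U B W /typedE[Γs [As [U' [V [W' [Q [-> -> -> []]]]]]]].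
  move=> As0 /typeds_Seq[? e ? h] tt.
  (* The rule for [Let] demands at least one term, so the path of values is nonempty and its
     boundary is the empty word. *)
  have ? : U' = [::] by apply: h => vs0; move: As0; rewrite e vs0.
  by subst; apply: typed_subst.
- move=> ts us v t A s r Γ e Δ U B W tl; move: (tl).
  move=> /typed_let_inv[Γs [As [U' [V [W' [Q [_ _ _ [_ + _]]]]]]]].
  move=> /typeds_pair[? [? [? [? [? [? [? [/typedE + /typedE]]]]]]]].
  (* The sent and the received type are both read off the first letter of the common boundary, so
     they coincide. *)
  move=> [? [? [_ -> _]]] [? [?]] _ _; subst A.
  by apply: typed_cut tl; apply: Cut; apply: CommR.
- move=> ts us v t A s r Γ e Δ U B W tl; move: (tl).
  move=> /typed_let_inv[Γs [As [U' [V [W' [Q [_ _ _ [_ + _]]]]]]]].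
  move=> /typeds_pair[? [? [? [? [? [? [? [/typedE + /typedE]]]]]]]].
  move=> [? -> _] [? [? [_ [?]]]] _ _; subst A.
  by apply: typed_cut tl; apply: Cut; apply: CommL.
- move=> us v t r Γ U B W /typedE[Γs [As [U' [V [W' [Q [-> -> -> []]]]]]]].
  move=> As0 /typedsE[Δ [A [Γs' [As' [X [-> eAs tt tus]]]]]] tr.
  have [Δ' [U'' [-> -> tt']]] := typedE tt.
  rewrite /= -catA; apply: T_putL'.
  by apply: (T_let (Γs := _ :: _)) As0 _ tr; rewrite eAs; apply: T_cons tus.
- move=> us A t r Γ U B W /typedE[Γs [As [U' [V [W' [Q [-> -> -> []]]]]]]].
  move=> As0 /typedsE[Δ [A' [Γs' [As' [X [-> eAs tt tus]]]]]] tr.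
  have [U'' -> tt'] := typedE tt.
  rewrite /=; apply: T_getL; apply: (T_let (Γs := (A :: Δ) :: Γs')) As0 _ tr.
  by rewrite eAs; apply: T_cons tus.
- move=> ts v t r Γ U B W /typedE[Γs [As [U' [V [W' [Q [-> -> -> []]]]]]]].
  move=> As0 /typeds_catE[Γs1 [Γs2 [As1 [As2 [X [-> eAs tts]]]]]].
  move=> /typedsE[Δ [A [Γs' [As' [Y [-> eAs2 tt]]]]]].
  move=> /typedsE[-> eAs' eY] tr.
  have [Δ' [W'' [-> eW tt']]] := typedE tt.
  rewrite -eY eW /= flatten_cat /= cats0 catA; apply: T_putR'.
  have -> : flatten Γs1 ++ Δ' = flatten (Γs1 ++ [:: Δ']).
    by rewrite flatten_cat /= cats0.
  apply: T_let As0 _ tr; rewrite eAs eAs2 eAs'; apply: typeds_cat tts _.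
  by apply: T_cons tt' _; apply: T_nil.
- move=> ts C t r Γ U B W /typedE[Γs [As [U' [V [W' [Q [-> -> -> []]]]]]]].
  move=> As0 /typeds_catE[Γs1 [Γs2 [As1 [As2 [X [-> eAs tts]]]]]].
  move=> /typedsE[Δ [A [Γs' [As' [Y [-> eAs2 tt]]]]]].
  move=> /typedsE[-> eAs' eY] tr.
  have [W'' eW tt'] := typedE tt.
  rewrite -eY eW /= flatten_cat /= cats0; apply: T_getR.
  have -> : (flatten Γs1 ++ Δ) ++ [:: C] = flatten (Γs1 ++ [:: Δ ++ [:: C]]).
    by rewrite flatten_cat /= cats0 catA.
  apply: T_let As0 _ tr; rewrite eAs eAs2 eAs'; apply: typeds_cat tts _.
  by apply: T_cons tt' _; apply: T_nil.
- move=> v w t Γ U B W /typedE[Δ [W' [-> -> /typedE[Δ' [U' [-> -> tt]]]]]].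
  by rewrite -catA; apply: T_putL'; apply: T_putR'.
- move=> v A t Γ U B W /typedE[Δ [W' [-> -> /typedE[U' -> tt]]]].
  exact: T_getL (T_putR' v tt).
- move=> v A t Γ e Δ U B W /typedE[W' -> /typedE[Δ' [U' [e' -> tt]]]].
  (* Since [t] has a last variable, the one bound by [GetR] is cancelled at the end of the context
     of [t] and leaves that of [v] intact. *)
  move: e'; rewrite -(typed_ctx tt) e catA !cats1 => /rcons_inj[->].
  by apply: T_putL'; apply: T_getR; rewrite -e (typed_ctx tt).
- move=> A A' t Γ U B W /typedE[W' -> /typedE[U' -> tt]].
  by apply: T_getL; apply: (T_getR (Γ := A' :: Γ)).
- move=> ts us t t' r _ IH Γ U B W.
  move=> /typedE[Γs [As [U' [V [W' [Q [-> -> -> []]]]]]]].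
  move=> As0 /typeds_catE[Γs1 [Γs2 [As1 [As2 [X [-> eAs tts]]]]]].
  move=> /typedsE[Δ [A [Γs' [As' [Y [-> eAs2 tt tus]]]]]] tr.
  apply: T_let As0 _ tr; rewrite eAs eAs2; apply: typeds_cat tts _.
  exact: T_cons (IH _ _ _ _ tt) tus.
- move=> ts r r' _ IH Γ U B W.
  move=> /typedE[Γs [As [U' [V [W' [Q [-> -> -> [As0 tts tr]]]]]]]].
  exact: T_let As0 tts (IH _ _ _ _ tr).
- move=> v t t' _ IH Γ U B W /typedE[Δ [W' [-> -> tt]]].
  exact: T_putR' (IH _ _ _ _ tt).
- move=> A t t' _ IH Γ U B W /typedE[U' -> tt].
  exact: T_getL (IH _ _ _ _ tt).
- move=> A t t' _ IH Γ U B W /typedE[U' -> tt].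
  exact: T_getR (IH _ _ _ _ tt).
- move=> v t t' _ IH Γ U B W /typedE[Δ [W' [-> -> tt]]].
  exact: T_putL' (IH _ _ _ _ tt).
Qed.

(** * Reduction sequences, of terms and of lists of terms *)

Definition red : raw M -> raw M -> Prop := clos_refl_trans _ (@step M).

Lemma red_refl t : red t t. Proof. exact: rt_refl. Qed.
Lemma red_step t t' : step t t' -> red t t'. Proof. exact: rt_step. Qed.
Lemma red_trans s t r : red s t -> red t r -> red s r. Proof. exact: rt_trans. Qed.

Lemma red_typed t t' Γ U B W : red t t' -> typed Γ t U B W -> typed Γ t' U B W.
Proof.
elim=> // [? ? /subject_reduction h|? ? ? _ IH1 _ IH2 /IH1/IH2]; last by [].
exact: h.
Qed.

Lemma red_morph (F : raw M -> raw M) :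
  (forall a b, step a b -> step (F a) (F b)) ->
  forall a b, red a b -> red (F a) (F b).
Proof.
move=> hF a b; elim=> [? ? /hF|?|? ? ? _ h1 _ h2]; first exact: red_step.
  exact: red_refl.
exact: red_trans h1 h2.
Qed.

Lemma red_lop o t t' : red t t' -> red (lop o t) (lop o t').
Proof.
by apply: red_morph => a b; case: o => ? ?; [apply: C_putL|apply: C_getL].
Qed.

Lemma red_rop o t t' : red t t' -> red (rop o t) (rop o t').
Proof.
by apply: red_morph => a b; case: o => ? ?; [apply: C_putR|apply: C_getR].
Qed.

Lemma red_let1 ts us t t' r : red t t' ->
  red (Let (ts ++ t :: us) r) (Let (ts ++ t' :: us) r).
Proof. by move: t t'; apply: red_morph => a b; apply: C_let1. Qed.

Lemma red_let2 ts r r' : red r r' -> red (Let ts r) (Let ts r').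
Proof. by apply: red_morph => a b; apply: C_let2. Qed.

Inductive reds : seq (raw M) -> seq (raw M) -> Prop :=
| reds_nil : reds [::] [::]
| reds_cons t t' ts ts' : red t t' -> reds ts ts' -> reds (t :: ts) (t' :: ts').

Lemma red_lets ts us us' r : reds us us' ->
  red (Let (ts ++ us) r) (Let (ts ++ us') r).
Proof.
move=> h; elim: h ts => [|t t' us1 us1' ht _ IH] ts; first exact: red_refl.
apply: red_trans (red_let1 ts us1 r ht) _.
by rewrite -!cat_rcons; apply: IH.
Qed.

Lemma red_let ts ts' r r' : reds ts ts' -> red r r' -> red (Let ts r) (Let ts' r').
Proof.
by move=> /(red_lets [::] r) h /(red_let2 ts'); apply: red_trans h.
Qed.

Lemma reds_cat ts ts' us us' : reds ts ts' -> reds us us' ->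
  reds (ts ++ us) (ts' ++ us').
Proof. by elim=> //= t t' {}ts {}ts' ht _ IH /IH; apply: reds_cons. Qed.

Lemma reds_typeds ts ts' : reds ts ts' ->
  forall Γs U As W, typeds Γs ts U As W -> typeds Γs ts' U As W.
Proof.
elim=> // t t' {}ts {}ts' ht _ IH Γs U As W.
move=> /typedsE[Γ [A [Γs' [As' [V [-> -> tt /IH tts]]]]]].
exact: T_cons (red_typed ht tt) tts.
Qed.

(** * Let-free terms and elimination of [Let] *)

Fixpoint nolet t : bool :=
  match t with
  | Seq _ => true
  | Let _ _ => false
  | PutR _ s | GetL _ s | GetR _ s | PutL _ s => nolet s
  end.

(** The measure of the later inductions: value substitution preserves it, while emitting an
    operation or communicating lowers it. *)
Fixpoint ops t : nat :=
  match t with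
  | Seq _ | Let _ _ => 0
  | PutR _ s | GetL _ s | GetR _ s | PutL _ s => (ops s).+1
  end.

Lemma nolet_subst t vs : nolet (subst t vs) = nolet t.
Proof. by elim: t vs => //=. Qed.

Lemma ops_subst t vs : ops (subst t vs) = ops t.
Proof. by elim: t vs => //= [v t IH|A t IH|A t IH|v t IH] vs; rewrite IH. Qed.

Lemma nolet_lop o t : nolet (lop o t) = nolet t. Proof. by case: o. Qed.
Lemma nolet_rop o t : nolet (rop o t) = nolet t. Proof. by case: o. Qed.
Lemma ops_lop o t : ops (lop o t) = (ops t).+1. Proof. by case: o. Qed.
Lemma ops_rop o t : ops (rop o t) = (ops t).+1. Proof. by case: o. Qed.

Lemma comm_nolet p x y x' y' : comm p x y x' y' ->
  (nolet x' = nolet x) * (nolet y' = nolet y).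
Proof. by case=> * /=; rewrite ?nolet_subst. Qed.

Lemma comm_ops p x y x' y' : comm p x y x' y' ->
  (ops x = (ops x').+1) * (ops y = (ops y').+1).
Proof. by case=> * /=; rewrite ?ops_subst. Qed.

Definition opss ts := sumn (map ops ts).

Lemma opss_cat ts us : opss (ts ++ us) = opss ts + opss us.
Proof. by rewrite /opss map_cat sumn_cat. Qed.

Lemma cut_nolet ts ts' : cut ts ts' -> all nolet ts' = all nolet ts.
Proof. by case=> hs p x y x' y' us c; rewrite !all_cat /= !(comm_nolet c). Qed.

Lemma cut_opss ts ts' : cut ts ts' -> opss ts' < opss ts.
Proof.
case=> hs p x y x' y' us c; rewrite !opss_cat ltn_add2l /opss /=.
by rewrite (comm_ops c).1 ltnS (comm_ops c).2 leq_add2l addSn; apply: leqnSn.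
Qed.

Variant op_view : raw M -> Prop :=
| VSeq v : op_view (Seq v)
| VL o t : op_view (lop o t)
| VR o t : op_view (rop o t).

Lemma opP t : nolet t -> op_view t.
Proof.
case: t => // [v|v t|A t|A t|v t] _; first exact: VSeq.
- exact: (VR (inl v)).
- exact: (VL (inr A)).
- exact: (VR (inr A)).
- exact: (VL (inl v)).
Qed.

(** Both operations are recorded by the same boundary letter. Its polarity rules out two sends and
    two receives, and its object makes the types agree. *)
Lemma rop_lop_comm o t o' s Γ Δ U A V B W :
  typed Γ (rop o t) U A V -> typed Δ (lop o' s) V B W ->
  exists x y, comm (rlab o) (rop o t) (lop o' s) x y.
Proof.
case: o => [v|C] + + ; case: o' => [w|C'] /typedE + /typedE.
- by move=> [? [? [_ -> _]]] [? [? [_ ? _]]].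
- move=> [? [? [_ -> _]]] [? [<- _] ts].
  by do 2 eexists; apply: CommR (typed_ctx ts).
- move=> [? -> tt] [? [? [_ [eC _] _]]]; subst C.
  by do 2 eexists; apply: CommL (typed_ctx tt).
- by move=> [? -> tt] [? ? _].
Qed.

Variant shape : seq (raw M) -> Prop :=
| ShV vs : shape (map (@Seq M) vs)
| ShL o t us : shape (lop o t :: us)
| ShR ts o t : shape (ts ++ [:: rop o t])
| ShC ts ts' : cut ts ts' -> shape ts.

(** The head is compared with the shape of the tail. A right operation leaves a nonempty boundary,
    so a tail of values must be empty and a left operation in front of the tail can communicate; a
    value leaves an empty boundary, which excludes such a left operation. *)
Lemma shapeP Γs ts U As W : typeds Γs ts U As W -> all nolet ts -> shape ts.
Proof.
elim: ts Γs U As => [|t ts IH] Γs U As; first by move=> *; apply: (ShV [::]).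
move=> /typedsE[Γ [A [Γs' [As' [V [_ _ tt tts]]]]]] /= /andP[/opP nt nts].
case: t / nt tt => [v|o t|o t] tt; last 2 first.
- exact: ShL.
- have [Γ' [V' [eV _]]] := typed_rop tt.
  have sh := IH _ _ _ tts nts; case: sh tts => [vs|o' s us|us o' s|us us' c] tts.
  + case: vs tts => [_|v vs]; first exact: (ShR [::]).
    by move=> /(@typeds_Seq (v :: vs))[_ _ _ h]; rewrite h in eV.
  + have [? [? [? [? [? [_ _ tus _]]]]]] := typedsE tts.
    have [x [y c]] := rop_lop_comm tt tus.
    exact: ShC (Cut [::] us c).
  + by rewrite -cat_cons; apply: ShR.
  + apply: ShC; have := cut_cat [:: rop o t] [::] c.
    by rewrite !cats0; apply.
- have [_ _ _ eV] := typedE tt.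
  have sh := IH _ _ _ tts nts; case: sh tts => [vs|o' s us|us o' s|us us' c] tts.
  + exact: (ShV (v :: vs)).
  + have [? [? [? [? [? [_ _ + _]]]]]] := typedsE tts.
    by move=> /typed_lop[? [? []]]; rewrite eV.
  + by rewrite -cat_cons; apply: ShR.
  + apply: ShC; have := cut_cat [:: Seq v] [::] c.
    by rewrite !cats0; apply.
Qed.

(** Induction on the operations in the path: they leave the [Let] or cancel in pairs, and [r] is
    touched only by the final R0. *)
Lemma let_elim_nolet ts r Γs U As W : typeds Γs ts U As W -> all nolet ts ->
  nolet r -> exists2 t, red (Let ts r) t & nolet t.
Proof.
have [n] := ubnP (opss ts); elim: n ts Γs U As W => // n IH ts Γs U As W.
rewrite ltnS => le_n tts nts nr.
have sh := shapeP tts nts; case: sh le_n tts nts => [vs|o t us|us o t|us us' c] le_n tts nts.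
- by exists (subst r vs); [apply: red_step; apply: R0|rewrite nolet_subst].
- have [? [? [? [? [? [_ _ tt tus]]]]]] := typedsE tts.
  have [? [? [_ tt']]] := typed_lop tt.
  have [|||u hu nu] := IH (t :: us) _ _ _ _ _ (T_cons tt' tus) => //.
  + by move: le_n; rewrite /opss /= ops_lop.
  + by move: nts; rewrite /= nolet_lop.
  exists (lop o u); last by rewrite nolet_lop.
  exact: red_trans (red_step (step_lop o t us r)) (red_lop o hu).
- have [? [? [? [? [? [_ _ tus]]]]]] := typeds_catE tts.
  move=> /typedsE[? [? [? [? [? [_ _ tt _]]]]]].
  have [? [? [_ tt']]] := typed_rop tt.
  have tus' := typeds_cat tus (T_cons tt' (T_nil _)).
  have [|||u hu nu] := IH _ _ _ _ _ _ tus' => //.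
  + by move: le_n; rewrite !opss_cat /opss /= ops_rop !addn0 addnS.
  + by move: nts; rewrite !all_cat /= nolet_rop.
  exists (rop o u); last by rewrite nolet_rop.
  exact: red_trans (red_step (step_rop us o t r)) (red_rop o hu).
- have [Γs' _ tus'] := cut_typeds c tts.
  have [|||u hu nu] := IH _ _ _ _ _ _ tus' => //.
  + exact: leq_trans (cut_opss c) le_n.
  + by rewrite (cut_nolet c).
  by exists u => //; apply: red_trans hu; apply: red_step; apply: step_cut.
Qed.

Lemma let_elim_mutual :
  (forall Γ t U B W, typed Γ t U B W -> exists2 t', red t t' & nolet t') /\
  (forall Γs ts U As W, typeds Γs ts U As W ->
     exists2 ts', reds ts ts' & all nolet ts').
Proof.
apply: typed_typeds_ind.
- by move=> Γ A v; exists (Seq (Arrow v)) => //; apply: red_refl.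
- move=> Γs As ts t U W V B Q As0 tts [ts' hts nts] tt [t' ht nt].
  have [u hu nu] := let_elim_nolet (reds_typeds hts tts) nts nt.
  by exists u => //; apply: red_trans hu; apply: red_let.
- move=> Δ Γ A v t U B W _ [t' ht nt]; exists (PutR (Arrow v) t') => //.
  exact: (red_rop (inl _)).
- move=> Γ A t U B W _ [t' ht nt]; exists (GetL A t') => //.
  exact: (red_lop (inr _)).
- move=> Γ A t U B W _ [t' ht nt]; exists (GetR A t') => //.
  exact: (red_rop (inr _)).
- move=> Γ Δ A v t U B W _ [t' ht nt]; exists (PutL (Arrow v) t') => //.
  exact: (red_lop (inl _)).
- by move=> U; exists [::] => //; apply: reds_nil.
- move=> Γ A Γs As t ts U V W _ [t' ht nt] _ [ts' hts nts].
  by exists (t' :: ts') => /=; [apply: reds_cons|rewrite nt].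
Qed.

(** * Common reducts and the unit laws *)

Definition join s t := exists2 u, red s u & red t u.

Lemma join_refl t : join t t. Proof. by exists t; apply: red_refl. Qed.

Lemma join_red s s' t t' : red s s' -> red t t' -> join s' t' -> join s t.
Proof.
by move=> hs ht [u hsu htu]; exists u; [apply: red_trans hsu|apply: red_trans htu].
Qed.

Lemma join_lop o s t : join s t -> join (lop o s) (lop o t).
Proof. by move=> [u hs ht]; exists (lop o u); apply: red_lop. Qed.

Lemma join_rop o s t : join s t -> join (rop o s) (rop o t).
Proof. by move=> [u hs ht]; exists (rop o u); apply: red_rop. Qed.

Lemma join_unitr f P As B Q : typed As f P B Q ->
  join (Let [seq Seq (idarr A) | A <- As] f) f.
Proof.
move=> tf; exists f; last exact: red_refl.
rewrite -{2}(subst_ids tf) map_comp; apply: red_step; exact: R0.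
Qed.

Lemma join_unitl f P As B Q : typed As f P B Q ->
  join (Let [:: f] (Seq (idarr B))) f.
Proof.
move=> tf; have [f' hf nf] := let_elim_mutual.1 _ _ _ _ _ tf.
exists f' => //; apply: red_trans (red_let1 [::] [::] _ hf) _.
move: (red_typed hf tf) => {hf tf f}; move: f' nf P As Q => t /=.
(* In a one-term path the term is both first and last, so each of its operations leaves by one of R3
   to R6; the final value is absorbed by R0 and the left unit law of [M]. *)
elim: t => // [v _|v t IH nt|C t IH nt|C t IH nt|v t IH nt] P As Q.
- move=> /typedE[_ -> _ _]; apply: red_step.
  by have := R0 [:: v] (Seq (idarr (cod v))); rewrite /= vsubst_idarr.
- move=> /(@typed_rop _ (inl v))[? [? [_ tt]]].
  by apply: red_trans (red_step (R5 [::] v t _)) (red_rop (inl v) (IH nt _ _ _ tt)).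
- move=> /(@typed_lop _ (inr C))[? [? [_ tt]]].
  by apply: red_trans (red_step (R4 [::] C t _)) (red_lop (inr C) (IH nt _ _ _ tt)).
- move=> /(@typed_rop _ (inr C))[? [? [_ tt]]].
  by apply: red_trans (red_step (R6 [::] C t _)) (red_rop (inr C) (IH nt _ _ _ tt)).
- move=> /(@typed_lop _ (inl v))[? [? [_ tt]]].
  by apply: red_trans (red_step (R3 [::] v t _)) (red_lop (inl v) (IH nt _ _ _ tt)).
Qed.

End Reduction.

(** * Identity wires and the relaying of messages *)

Section Associativity.
Variable M : multicategory.
Local Notation arr := (arrow (@hom M)).
Implicit Types (Γ Δ As : seq (ob M)) (U V W P Q : word M) (A B : ob M).
Implicit Types (t s r f g x y : raw M) (ts us hs gs : seq (raw M)).
Implicit Types (v : arr) (vs : seq arr) (p : ob M * polarity) (o : arr + ob M).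

(** When the message is an identity, the substitution made by the communication is trivial. *)
Lemma commR_id A t s Γ U B W : typed (A :: Γ) s U B W ->
  comm (A, circ) (PutR (idarr A) t) (GetL A s) t s.
Proof.
by move=> ts; have := CommR (v := idarr A) t (typed_ctx ts); rewrite (subst_ids ts).
Qed.

Lemma commL_id A t s Γ U B W : typed (Γ ++ [:: A]) t U B W ->
  comm (A, bullet) (GetR A t) (PutL (idarr A) s) t s.
Proof.
move=> tt; have := CommL (v := idarr A) s (typed_ctx tt).
by rewrite -(map_cat (@idarr M) Γ [:: A]) (subst_ids tt).
Qed.

(** The terms that can be composed with an empty path, hence be wrapped in a wire; boolean, so that
    [all] applies. *)
Definition closed g : bool := `[< exists U B W, typed [::] g U B W >].

Lemma closed_idU U g : closed g -> closed (idU_raw U g).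
Proof.
move=> /asboolP[T [B [T' tg]]]; apply/asboolP.
by exists (U ++ T), B, (U ++ T'); apply: idU_typed.
Qed.

Lemma closed_ctx g : closed g -> ctx g = [::].
Proof. by move=> /asboolP[T [B [T' /typed_ctx]]]. Qed.

Lemma closed_subst g : closed g -> subst g [::] = g.
Proof. by move=> /asboolP[T [B [T' /subst_ids]]]. Qed.

(** A wire that has received [v] on its left is about to send [v] on its right: [v] replaces the
    variable in [PutR (idarr _) _]. *)
Lemma commR_idU v t g U : closed g ->
  comm (cod v, circ) (PutR v t) (idU_raw ((cod v, circ) :: U) g)
    t (PutR v (idU_raw U g)).
Proof.
move=> /(closed_idU U) cg.
have e : ctx (PutR (idarr (cod v)) (idU_raw U g)) = [:: cod v].
  by rewrite /= closed_ctx.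
have := CommR t e.
by rewrite /= closed_ctx //= vsubst_idarr closed_subst.
Qed.

Lemma commL_idU v s g U : closed g ->
  comm (cod v, bullet) (idU_raw ((cod v, bullet) :: U) g) (PutL v s)
    (PutL v (idU_raw U g)) s.
Proof.
move=> /(closed_idU U) cg.
have e : ctx (PutL (idarr (cod v)) (idU_raw U g)) = [::] ++ [:: cod v].
  by rewrite /= closed_ctx.
have := CommL s e.
by rewrite /= vsubst_idarr closed_subst.
Qed.

(* Identity wires [idU_raw U g] between two communicating terms relay the
   message. *)
Lemma red_relay p x y x' y' ts gs us U r :
  comm p x y x' y' -> all closed gs ->
  red (Let (ts ++ x :: map (idU_raw (p :: U)) gs ++ y :: us) r)
      (Let (ts ++ x' :: map (idU_raw U) gs ++ y' :: us) r).
Proof.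
case=> v t s Γ e.
  elim: gs ts t => [|g gs IH] ts t.
    by move=> _; apply: red_step; apply: step_comm; apply: CommR.
  move=> /andP[cg cgs]; rewrite !map_cons !cat_cons.
  apply: red_trans (red_step (step_comm _ _ _ (commR_idU v t U cg))) _.
  by rewrite -!(cat_rcons t); apply: IH.
(* Messages of polarity [bullet] travel from right to left, so here the wires are peeled off from
   the right end. *)
elim/last_ind: gs us s => [|gs g IH] us s.
  by move=> _; apply: red_step; apply: step_comm; apply: CommL.
rewrite all_rcons => /andP[cg cgs]; rewrite !map_rcons !cat_rcons.
apply: red_trans (IH _ _ cgs).
rewrite -!cat_cons !catA.
exact: red_step (step_comm _ _ _ (commL_idU v s U cg)).
Qed.

(** A sent value is relayed to the first wire, which emits it. For a receive, the first wire emits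
    its own [GetL] and then relays the bound variable to [s]. *)
Lemma red_relay_lop o s gs us U r Δ T B W : all closed gs ->
  typed Δ (lop o s) T B W ->
  red (Let (map (idU_raw (llab o :: U)) gs ++ lop o s :: us) r)
      (lop o (Let (map (idU_raw U) gs ++ s :: us) r)).
Proof.
case: gs => [|g gs] /= => [_ _|/andP[cg cgs]].
  exact: red_step (step_lop _ _ _ _).
case: o => [v|A] /typedE.
  move=> _; apply: red_trans (red_relay [::] us U r (commL_idU v s U cg) cgs) _.
  exact: red_step (step_lop (inl v) _ _ _).
move=> [T' _ ts].
apply: red_trans (red_step (step_lop (inr A) _ _ _)) _.
exact: (red_lop (inr A) (red_relay [::] us U r (commR_id _ ts) cgs)).
Qed.

Lemma red_relay_rop o t gs ts U r Δ T B W : all closed gs ->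
  typed Δ (rop o t) T B W ->
  red (Let (ts ++ rop o t :: map (idU_raw (rlab o :: U)) gs) r)
      (rop o (Let (ts ++ t :: map (idU_raw U) gs) r)).
Proof.
elim/last_ind: gs => [|gs g _].
  by move=> *; apply: red_step (step_rop _ _ _ _).
rewrite all_rcons !map_rcons -!cats1 => /andP[cg cgs].
case: o => [v|A] /typedE.
  move=> _; apply: red_trans (red_relay ts [::] U r (commR_idU v t U cg) cgs) _.
  rewrite -!cat_cons !catA.
  exact: red_step (step_rop _ (inl v) _ _).
move=> [T' _ tt].
have := red_relay ts [::] U r (commL_id (idU_raw U g) tt) cgs.
rewrite -!cat_cons !catA => h; apply: red_trans (red_rop (inr A) h).
exact: red_step (step_rop _ (inr A) _ _).
Qed.

(** Each letter of [U] is received at one end of the row of wires, relayed through it and sent at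
    the other end; the row thus acts as a single wire around the composite. *)
Lemma red_let_idU g gs U r : all closed (g :: gs) ->
  red (Let (map (idU_raw U) (g :: gs)) r) (idU_raw U (Let (g :: gs) r)).
Proof.
move=> cgs; elim: U => [|[A []] U IH].
- by rewrite [map _ _]map_id; apply: red_refl.
- case/andP: (cgs) => /(closed_idU U)/asboolP[T [B [T' tg]]] cgs'.
  apply: red_trans (red_step (R4 _ _ _ _)) _.
  apply: red_trans (red_lop (inr A) (red_rop (inl (idarr A)) IH)).
  apply: (red_lop (inr A)).
  exact: (red_relay_rop (o := inl (idarr A)) [::] _ _ cgs' (T_putR (ident A) tg)).
- move: cgs IH; rewrite [g :: gs]lastI; move: (belast _ _) (last _ _) => {g}gs g.
  rewrite all_rcons => /andP[/(closed_idU U)/asboolP[T [B [T' tg]]] cgs] IH.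
  apply: red_trans (red_rop (inr A) (red_lop (inl (idarr A)) IH)).
  rewrite !map_rcons -!cats1.
  apply: red_trans (red_step (R6 _ _ _ _)) _.
  apply: (red_rop (inr A)).
  exact: (red_relay_lop (o := inl (idarr A)) [::] _ _ cgs (T_putL (ident A) tg)).
Qed.

(** * Iterated composites as lists of groups, and their shapes *)

Definition rcomp U g hs := if hs is [::] then idU_raw U g else Let hs g.

Lemma rcomp_cons U g ts x us : rcomp U g (ts ++ x :: us) = Let (ts ++ x :: us) g.
Proof. by case: ts. Qed.

(* One factor g o (h_1, .., h_k) of an iterated composite; the word records the
   left boundary of the path (h_1, .., h_k), which matters only for k = 0. *)
Record group := Group { gword : word M; gout : raw M; gin : seq (raw M) }.

Definition gcomp (x : group) := rcomp (gword x) (gout x) (gin x).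
Definition gins (n : seq group) := flatten (map gin n).
Definition wires U gs := [seq Group U g [::] | g <- gs].

Inductive groups : word M -> word M -> seq group -> Prop :=
| GNil U : groups U U [::]
| GCons Γ g T A T' Ξs hs U V W n : typed Γ g T A T' -> typeds Ξs hs U Γ V ->
    groups V W n -> groups U W (Group U g hs :: n).

Lemma groupsE U W n : groups U W n ->
  match n with
  | [::] => U = W
  | x :: n' => gword x = U /\ exists Γ T A T' Ξs V,
      [/\ typed Γ (gout x) T A T', typeds Ξs (gin x) U Γ V & groups V W n']
  end.
Proof.
by case=> {U W n} // Γ g T A T' Ξs hs U V W n ? ? ?; split=> //; exists Γ, T, A, T', Ξs, V.
Qed.

Lemma groups_cat U V W n1 n2 : groups U V n1 -> groups V W n2 ->
  groups U W (n1 ++ n2).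
Proof.
by elim=> // Γ g T A T' Ξs hs {}U X {}V n tg ths _ IH /IH; apply: GCons tg ths.
Qed.

Lemma groups_catE U W n1 n2 : groups U W (n1 ++ n2) ->
  exists2 V, groups U V n1 & groups V W n2.
Proof.
elim: n1 U => [|[w g hs] n1 IH] U /=; first by exists U => //; apply: GNil.
move=> /groupsE[/= -> [Γ [T [A [T' [Ξs [X [tg ths /IH[V h1 h2]]]]]]]]].
by exists V => //; apply: GCons tg ths h1.
Qed.

Lemma groups_wires U gs : all closed gs -> groups U U (wires U gs).
Proof.
elim: gs => [_|g gs IH /= /andP[/asboolP[T [A [T' tg]]] /IH]]; first exact: GNil.
by apply: GCons tg _; apply: T_nil.
Qed.

(** The last equation also serves the empty list, whose word [w] is not determined by the typing. *)
Lemma groups_wiresE U W w gs : groups U W (wires w gs) ->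
  [/\ U = W, all closed gs & wires w gs = wires U gs].
Proof.
elim: gs => [/groupsE|g gs IH] //= /groupsE[/= ew [Γ [T [A [T' [Ξs [X]]]]]]].
subst w; move=> [tg /typedsE[_ eΓ eX]]; subst => /IH[<- cgs _]; split => //=.
by rewrite cgs andbT; apply/asboolP; exists T, A, T'.
Qed.

Lemma gins_cat n1 n2 : gins (n1 ++ n2) = gins n1 ++ gins n2.
Proof. by rewrite /gins map_cat flatten_cat. Qed.

Lemma gins_wires U gs : gins (wires U gs) = [::].
Proof. by elim: gs. Qed.

Lemma gcomp_wires U gs : map gcomp (wires U gs) = map (idU_raw U) gs.
Proof. by rewrite -map_comp. Qed.

Lemma gout_wires U gs : map gout (wires U gs) = gs.
Proof. by elim: gs => //= g gs ->. Qed.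

(** Either no value occurs and all groups are wires at one word, or a value occurs and forces the
    boundaries to be empty, also across the wires. *)
Lemma groups_values U W n vss : groups U W n ->
  map gin n = map (map (@Seq M)) vss ->
  (exists gs, n = wires U gs) \/ [/\ U = [::], W = [::] & flatten vss <> [::]].
Proof.
move=> h; elim: h vss => {U W n}.
  by left; exists [::].
move=> Γ g T A T' Ξs hs U V W n _ ths hn IH [//|vs vss] [ehs /IH{}IH].
move: ths; rewrite {}ehs; case: vs => [/typedsE[_ _ ->]|v vs].
  case: IH => [[gs ->]|[-> -> h]]; last by right.
  by left; exists (g :: gs).
move=> /(@typeds_Seq _ (v :: vs))[_ _ e h]; right; split => //; first exact: h.
rewrite -e h // in IH hn.
by case: IH hn => [[gs ->] /groups_wiresE[]|[]].
Qed.

(** The refinement of [shape] that sees the borders between groups. Wires may precede a group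
    emitting on the left ([GL]), follow one emitting on the right ([GR]), or separate two
    communicating groups ([GX]); [GC] is a communication within one group. *)
Variant gshape : seq group -> Prop :=
| GV n vss : map gin n = map (map (@Seq M)) vss -> gshape n
| GL w gs w' g o t b n : gshape (wires w gs ++ Group w' g (lop o t :: b) :: n)
| GR n w g a o t w' gs : gshape (n ++ Group w g (a ++ [:: rop o t]) :: wires w' gs)
| GC n w g hs hs' n' : cut hs hs' -> gshape (n ++ Group w g hs :: n')
| GX n w g a p x y x' y' w' gs w'' g' b n' : comm p x y x' y' ->
    gshape (n ++ Group w g (a ++ [:: x])
              :: wires w' gs ++ Group w'' g' (y :: b) :: n').

Lemma groups_lop U W w gs w' g o t b n :
  groups U W (wires w gs ++ Group w' g (lop o t :: b) :: n) ->
  [/\ all closed gs, wires w gs = wires U gs, w' = U &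
      exists U' Γ T A T' Ξs V, [/\ U = llab o :: U', typed Γ g T A T',
        0 < size Γ, typeds Ξs (lop o t :: b) U Γ V & groups V W n]].
Proof.
move=> /groups_catE[V /groups_wiresE[-> cgs ->]].
move=> /groupsE[/= -> [Γ [T [A [T' [Ξs [X [tg ths hn]]]]]]]]; split => //.
have [? [? [? [? [? [_ eΓ tt _]]]]]] := typedsE ths.
have [Δ [U' [eU _]]] := typed_lop tt.
by exists U', Γ, T, A, T', Ξs, X; rewrite {2}eΓ.
Qed.

Lemma gshapeP U W n : groups U W n -> all (@nolet M) (gins n) -> gshape n.
Proof.
elim=> {U W n}; first by move=> *; apply: (GV (vss := [::])).
move=> Γ g T A T' Ξs hs U V W n tg ths hn IH.
rewrite /gins /= -/(gins n) all_cat => /andP[nhs /IH{}IH].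
have sh := shapeP ths nhs; case: sh ths {nhs} => [vs|o t us|us o t|us us' c] ths.
- case: IH hn => {n} [n vss e|w gs w' g' o t b n|||] hn.
  + by apply: (GV (vss := vs :: vss)); rewrite /= e.
  + have [_ -> -> [V' [? [? [? [? [? [? [eV _ _ _ _]]]]]]]]] := groups_lop hn.
    (* An empty first group is one more wire in front; a value in it would empty the boundary at
       which the left operation waits. *)
    case: vs ths => [/typedsE[_ _ ->]|v vs].
      exact: (GL V (g :: gs) V g' o t b n).
    by move=> /(@typeds_Seq _ (v :: vs))[_ _ e h]; rewrite -e h in eV.
  + by move=> *; rewrite -cat_cons; apply: GR.
  + by move=> * ; rewrite -cat_cons; apply: GC; eauto.
  + by move=> * ; rewrite -cat_cons; apply: GX; eauto.
- exact: (GL U [::]).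
- have [? [? [? [? [? [_ _ _]]]]]] := typeds_catE ths.
  move=> /typedsE[? [? [? [? [? [_ _ tt /typedsE[_ _ eV]]]]]]]; subst.
  have [? [V' [eV _]]] := typed_rop tt.
  case: IH hn => {n} [n vss e|w gs w' g' o' s b n|||] hn.
  (* The letter of the right operation makes the boundary nonempty, so the groups behind it are all
     wires. *)
  + have [[gs ->]|[]] := groups_values hn e; last by rewrite eV.
    exact: (GR [::]).
  + have [_ -> -> [? [? [? [? [? [? [? [_ _ _ + _]]]]]]]]] := groups_lop hn.
    move=> /typedsE[? [? [? [? [? [_ _ ts _]]]]]].
    by have [x [y c]] := rop_lop_comm tt ts; apply: (GX [::] _ _ _ _ _ _ _ _ _ c).
  + by move=> *; rewrite -cat_cons; apply: GR.
  + by move=> * ; rewrite -cat_cons; apply: GC; eauto.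
  + by move=> * ; rewrite -cat_cons; apply: GX; eauto.
- exact: (GC [::] _ _ _ c).
Qed.

Lemma substs_ids_cat Ξs ts U As W us vs : typeds Ξs ts U As W ->
  substs (ts ++ us) (map (@idarr M) (flatten Ξs) ++ vs) = ts ++ substs us vs.
Proof.
elim: ts Ξs U As => [|t ts IH] Ξs U As.
  by move=> /typedsE[-> _ _].
move=> /typedsE[Γ [A [Ξs' [As' [X [-> _ tt tts]]]]]] /=.
rewrite (typed_ctx tt) map_cat -catA take_size_cat ?size_map //.
by rewrite drop_size_cat ?size_map // (subst_ids tt) (IH _ _ _ tts).
Qed.

(* The factors of a composite communicate through their boundary whenever the
   adjacent terms at that boundary do. *)
Lemma comm_let p x y x' y' a b g g' Ξs U As V Ξs' U' As' V' :
  comm p x y x' y' -> typeds Ξs a U As V -> typeds Ξs' b U' As' V' ->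
  exists X Y, [/\ step (Let (a ++ [:: x]) g) X, step (Let (y :: b) g') Y &
    comm p X Y (Let (a ++ [:: x']) g) (Let (y' :: b) g')].
Proof.
case=> v t s Γ e ta tb.
  exists (PutR v (Let (a ++ [:: t]) g)), (GetL (cod v) (Let (s :: b) g')).
  split; [exact: R5|exact: R4|].
  have e' : ctx (Let (s :: b) g') = cod v :: Γ ++ flatten Ξs'.
    by rewrite /= e (typeds_ctx tb).
  have := CommR (Let (a ++ [:: t]) g) e'.
  rewrite subst_let /= e /= map_cat take_size_cat ?size_map //.
  by rewrite drop_size_cat ?size_map // (substs_ids tb).
exists (GetR (cod v) (Let (a ++ [:: t]) g)), (PutL v (Let (s :: b) g')).
split; [exact: R6|exact: R3|].
have e' : ctx (Let (a ++ [:: t]) g) = (flatten Ξs ++ Γ) ++ [:: cod v].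
  by rewrite /= map_cat flatten_cat /= cats0 e (typeds_ctx ta) catA.
have := CommL (Let (s :: b) g') e'.
rewrite subst_let map_cat -catA (substs_ids_cat _ _ ta) /= e.
by rewrite take_oversize // !size_cat size_map.
Qed.

(** * Associativity by simulating the moves of the inner path *)

Lemma reds_values W n vss : groups [::] W n ->
  map gin n = map (map (@Seq M)) vss ->
  reds (map gcomp n) (substs (map gout n) (flatten vss)).
Proof.
elim: n vss => [|[w g hs] n IH] vss; first by move=> *; apply: reds_nil.
move=> /groupsE[/= -> [Γ [T [A [T' [Ξs [X [tg ths hn]]]]]]]].
case: vss => //= vs vss [ehs /IH{}IH]; subst hs.
have [_ eΓ eX _] := typeds_Seq ths; subst Γ; rewrite -eX in hn.
have e : size (ctx g) = size vs by rewrite (typed_ctx tg) size_map.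
rewrite e take_size_cat // drop_size_cat //; apply: reds_cons (IH hn).
(* A factor with an empty inner path is a wire at the empty word, that is [g] itself, and no value
   is substituted into it. *)
case: vs tg {ths e} => [|v vs] tg; last by apply: red_step; exact: (R0 (v :: vs)).
by rewrite (subst_ids tg); apply: red_refl.
Qed.

(** Every move comes from the inner path alone, so no type is asked of [f]. On one side the move is
    made in a factor and then between factors; on the other it is a single step of the concatenated
    path. *)
Lemma join_assoc U W n f : groups U W n -> n <> [::] -> all (@nolet M) (gins n) ->
  join (Let (map gcomp n) f) (rcomp U (Let (map gout n) f) (gins n)).
Proof.
have [m] := ubnP (opss (gins n)); elim: m U W n => // m IH U W n.
rewrite ltnS => le_m hn n0 nn.
have sh := gshapeP hn nn; case: sh hn n0 nn le_m => {n}.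
- move=> n vss e hn n0 _ _.
  have [[gs en]|[eU _ vss0]] := groups_values hn e.
    (* Without values, one side is a row of wires and the other is one wire around the composite of
       the outer terms. *)
    subst n; rewrite gins_wires gcomp_wires gout_wires.
    have [_ cgs _] := groups_wiresE hn.
    case: gs cgs n0 {e hn} => // g gs cgs _.
    by exists (idU_raw U (Let (g :: gs) f)); [apply: red_let_idU|apply: red_refl].
  (* With a value present, one side applies R0 in each factor that has values; the other applies R0
     once, and the substitution distributes over the outer terms. *)
  subst U; exists (Let (substs (map gout n) (flatten vss)) f).
    exact: red_let (reds_values hn e) (red_refl f).
  rewrite /gins e -map_flatten.
  case E: (flatten vss) vss0 => [//|v vs] _.
  by rewrite -subst_let; apply: red_step; exact: (R0 (v :: vs)).
- move=> w gs w' g o t b n /groups_lop[cgs -> ->].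
  move=> [U' [Γ [T [A [T' [Ξs [V [eU tg Γ0 ths hn]]]]]]]] _.
  subst U; have ths' := ths.
  have [Δ [C [Ξs' [Γ' [X [_ eΓ tt tb]]]]]] := typedsE ths'.
  have [Δ' [U'' [[?] tt']]] := typed_lop tt; subst U''.
  (* The emission removes the letter [llab o] from every wire in front as well. *)
  pose n' := wires U' gs ++ Group U' g (t :: b) :: n.
  have hn' : groups U' W n'.
    apply: groups_cat (groups_wires _ cgs) _; apply: GCons tg _ hn.
    by rewrite eΓ; apply: T_cons tt' tb.
  have := fun h => IH _ _ _ h hn'; rewrite /n' !gins_cat !gins_wires !map_cat.
  rewrite !gcomp_wires !gout_wires /gins /= -!/(gins _) => {}IH nn le_m.
  apply: join_red (join_lop o (IH _ _ _)).
  + have tl := subject_reduction (step_lop o t b g) (T_let Γ0 ths tg).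
    apply: red_trans (red_relay_lop _ _ _ cgs tl).
    by apply: red_let1; apply: red_step; apply: step_lop.
  + exact: red_step (step_lop _ _ _ _).
  + by move: le_m; rewrite /opss /= ops_lop.
  + by case: (gs).
  + by move: nn; rewrite nolet_lop.
- move=> n w g a o t w' gs /groups_catE[V hn].
  move=> /groupsE[/= -> [Γ [T [A [T' [Ξs [X [tg ths]]]]]]]].
  move=> /groups_wiresE[? cgs ->] _; subst X.
  have [Ξs1 [Ξs2 [As1 [As2 [Y [_ eΓ ta]]]]]] := typeds_catE ths.
  move=> /typedsE[Δ [C [? [? [? [_ eAs2 tt /typedsE[_ e eW]]]]]]]; subst.
  have [Δ' [W' [? tt']]] := typed_rop tt; subst.
  pose n' := n ++ Group V g (a ++ [:: t]) :: wires W' gs.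
  have hn' : groups U W' n'.
    apply: groups_cat hn _; apply: GCons tg _ (groups_wires _ cgs).
    by apply: typeds_cat ta _; apply: T_cons tt' _; apply: T_nil.
  have Γ0 : 0 < size (As1 ++ [:: C]) by rewrite size_cat addn1.
  have := fun h => IH _ _ _ h hn'; rewrite /n' !gins_cat !map_cat /=.
  rewrite /gins /= -!/(gins _) !gins_wires !cats0 !gcomp_wires !gout_wires.
  rewrite !catA !rcomp_cons /gcomp /= !rcomp_cons => {}IH nn le_m.
  apply: join_red (join_rop o (IH _ _ _)).
  + have tl := subject_reduction (step_rop a o t g) (T_let Γ0 ths tg).
    apply: red_trans (red_relay_rop _ _ _ cgs tl).
    by apply: red_let1; apply: red_step; apply: step_rop.
  + exact: red_step (step_rop _ _ _ _).
  + by move: le_m; rewrite !opss_cat /opss /= ops_rop !addn0 addnS.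
  + by case: (n).
  + by move: nn; rewrite !all_cat /= nolet_rop.
- move=> n w g hs hs' n2 c /groups_catE[V hn].
  move=> /groupsE[/= -> [Γ [T [A [T' [Ξs [X [tg ths hn2]]]]]]]] _ nn le_m.
  have [Ξs' _ ths'] := cut_typeds c ths.
  have hn' := groups_cat hn (GCons tg ths' hn2).
  have := fun h => IH _ _ _ h hn'.
  have c' := cut_cat (gins n) (gins n2) c.
  have E h : gins (n ++ Group V g h :: n2) = gins n ++ h ++ gins n2.
    by rewrite gins_cat.
  rewrite !E in nn le_m *; rewrite !map_cat /= => {}IH.
  apply: join_red (IH _ _ _).
  + apply: red_let1; case: c => *; rewrite /gcomp /= !rcomp_cons.
    by apply: red_step; apply: step_comm; eauto.
  + have := step_cut (Let (map gout n ++ g :: map gout n2) f) c'.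
    by case: c' => *; rewrite !rcomp_cons; apply: red_step.
  + exact: leq_trans (cut_opss c') le_m.
  + by case: (n).
  + by rewrite (cut_nolet c').
- move=> n w g a p x y x' y' w' gs w'' g' b n2 c /groups_catE[V hn].
  move=> /groupsE[/= -> [Γ [T [A [T' [Ξs [X [tg ths]]]]]]]].
  move=> /groups_catE[Y /groups_wiresE[<- cgs ->]].
  move=> /groupsE[/= -> [Γ2 [T2 [A2 [T2' [Ξs2 [Z [tg' ths2 hn2]]]]]]]] _ nn le_m.
  have [Ξs1 [? [As1 [? [? [_ eΓ ta]]]]]] := typeds_catE ths.
  move=> /typedsE[Δ [C [? [? [? [_ ? tx /typedsE[_ ? ?]]]]]]]; subst.
  have [Δ2 [C2 [Ξs3 [As3 [? [_ ? ty tb]]]]]] := typedsE ths2; subst.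
  have [Δ' [Δ2' [U' [? _ tx' ty']]]] := comm_typed c tx ty; subst.
  pose n' := n ++ Group V g (a ++ [:: x'])
    :: wires U' gs ++ Group U' g' (y' :: b) :: n2.
  have hn' : groups U W n'.
    apply: groups_cat hn _; apply: GCons tg _ _.
      by apply: typeds_cat ta _; apply: T_cons tx' _; apply: T_nil.
    apply: groups_cat (groups_wires _ cgs) _; apply: GCons tg' _ hn2.
    exact: T_cons ty' tb.
  have E u z z' : gins (n ++ Group V g (a ++ [:: z])
      :: wires u gs ++ Group u g' (z' :: b) :: n2) =
      (gins n ++ a) ++ z :: z' :: b ++ gins n2.
    rewrite gins_cat -!catA; congr (_ ++ _).
    by rewrite /gins /= -/(gins _) gins_cat gins_wires -catA.
  have c' := Cut (gins n ++ a) (b ++ gins n2) c.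
  have := fun h => IH _ _ _ h hn'; rewrite !E in nn le_m *; rewrite !rcomp_cons.
  rewrite !map_cat /= !map_cat !gcomp_wires !gout_wires => {}IH.
  have [X' [Y' [hX hY C']]] := comm_let g g' c ta tb.
  apply: join_red (IH _ _ _).
  + rewrite /gcomp /= !rcomp_cons.
    (* Both factors first bring their operation to their outer border; the wires in between then
       relay the message. *)
    apply: red_trans (red_let1 _ _ _ (red_step hX)) _.
    apply: red_trans (red_relay _ _ _ _ C' cgs).
    rewrite -!cat_cons !catA.
    exact: red_let1 (red_step hY).
  + exact: red_step (step_cut _ c').
  + exact: leq_trans (cut_opss c') le_m.
  + by rewrite /n'; case: (n).
  + by rewrite (cut_nolet c').
Qed.

End Associativity.

(** * From reductions of raw terms to equalities of cells *)

Section Cells.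
Variable M : multicategory.
Implicit Types (Γ Δ As : seq (ob M)) (U V W P Q : word M) (A B : ob M).
Implicit Types (t s r f g : raw M) (ts us hs gs : seq (raw M)) (n : seq (group M)).

Lemma red_rcomp U g hs hs' : reds hs hs' -> red (rcomp U g hs) (rcomp U g hs').
Proof.
case=> [|t t' ts ts' ht hts]; first exact: red_refl.
exact: red_let (reds_cons ht hts) (red_refl g).
Qed.

Lemma groups_nolet U W n : groups U W n -> exists n',
  [/\ groups U W n', map (@gout M) n' = map (@gout M) n,
      reds (map (@gcomp M) n) (map (@gcomp M) n'), reds (gins n) (gins n') &
      all (@nolet M) (gins n')].
Proof.
elim=> {U W n} [U|Γ g T A T' Ξs hs U V W n tg ths _ [n' [hn' en hc hi nn]]].
  by exists [::]; split=> //; [apply: GNil|apply: reds_nil|apply: reds_nil].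
have [hs' hhs nhs] := (let_elim_mutual M).2 _ _ _ _ _ ths.
exists (Group U g hs' :: n'); split.
- exact: GCons tg (reds_typeds hhs ths) hn'.
- by rewrite /= en.
- by apply: reds_cons hc; apply: red_rcomp.
- exact: reds_cat hhs hi.
- by rewrite /gins /= -/(gins _) all_cat nhs.
Qed.

Lemma idU_raw_cat U V t : idU_raw (U ++ V) t = idU_raw U (idU_raw V t).
Proof. by elim: U => //= -[A []] U ->. Qed.

Lemma join_rcompA U W T n f : groups U W n ->
  join (rcomp (U ++ T) f (map (@gcomp M) n))
       (rcomp U (rcomp T f (map (@gout M) n)) (gins n)).
Proof.
(* For the empty list the law says that wires compose along concatenation of words. *)
case: n => [|x n] hn; first by rewrite /= idU_raw_cat; apply: join_refl.
have [n' [hn' en hc hi nn]] := groups_nolet hn.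
apply: join_red (red_rcomp _ _ hc) (red_rcomp _ _ hi) _.
rewrite -en; have n0 : n' <> [::] by case: (n') en.
have := join_assoc f hn' n0 nn.
by case: (n') n0.
Qed.

Lemma join_rcomp_unitr f P As B Q : typed As f P B Q ->
  join (rcomp [::] f [seq Seq (idarr A) | A <- As]) f.
Proof. by case: As => [_|A As /join_unitr //]; apply: join_refl. Qed.

(** Conversion at a fixed type, on raw terms without attached typing proofs; proof irrelevance makes
    it agree with [conv]. *)
Definition tstep Γ U B W s t : Prop :=
  [/\ typed Γ s U B W, typed Γ t U B W & step s t].

Definition rconv Γ U B W : raw M -> raw M -> Prop :=
  clos_refl_sym_trans _ (tstep Γ U B W).

Lemma rconv_typed Γ U B W s t : rconv Γ U B W s t ->
  typed Γ s U B W <-> typed Γ t U B W.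
Proof. by elim=> [? ? []|?|? ? _ []|? ? ? _ [? ?] _ [? ?]] //; split; auto. Qed.

Lemma conv_rconv Γ U B W (a b : term U Γ B W) :
  conv a b -> rconv Γ U B W (sval a) (sval b).
Proof.
elim=> [x y h|x|x y _|x y z _ h1 _ h2]; last exact: rst_trans h1 h2.
- by apply: rst_step; split; [exact: svalP x|exact: svalP y|].
- exact: rst_refl.
- exact: rst_sym.
Qed.

Lemma rconv_conv Γ U B W (a b : term U Γ B W) :
  rconv Γ U B W (sval a) (sval b) -> conv a b.
Proof.
case: a b => [s hs] [t ht] /= h; elim: h hs ht => {s t}.
- by move=> s t [_ _ h] hs ht; apply: rst_step.
- by move=> t hs ht; rewrite (Prop_irrelevance hs ht); apply: rst_refl.
- by move=> s t _ IH hs ht; apply: rst_sym; apply: IH.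
- move=> s r t h1 IH1 _ IH2 hs ht; have hr := (rconv_typed h1).1 hs.
  exact: rst_trans (IH1 hs hr) (IH2 hr ht).
Qed.

Lemma rconv_morph (F : raw M -> raw M) Γ U B W Δ P A Q :
  (forall s t, step s t -> step (F s) (F t)) ->
  (forall t, typed Γ t U B W -> typed Δ (F t) P A Q) ->
  forall s t, rconv Γ U B W s t -> rconv Δ P A Q (F s) (F t).
Proof.
move=> hF hT s t; elim=> [{}s {}t [hs ht h]|x|x y _|x y z _ h1 _ h2].
- by apply: rst_step; split; auto.
- exact: rst_refl.
- exact: rst_sym.
- exact: rst_trans h1 h2.
Qed.

Lemma red_rconv Γ U B W s t : typed Γ s U B W -> red s t -> rconv Γ U B W s t.
Proof.
move=> hs h; elim: h hs => [x y h hx|x _|x y z h1 IH1 _ IH2 hx].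
- by apply: rst_step; split => //; exact: (subject_reduction h hx).
- exact: rst_refl.
- exact: rst_trans (IH1 hx) (IH2 (red_typed h1 hx)).
Qed.

Lemma join_conv Γ U B W (a b : term U Γ B W) : join (sval a) (sval b) -> conv a b.
Proof.
move=> [u /(red_rconv (svalP a)) ha /(red_rconv (svalP b)) hb].
by apply: rconv_conv; apply: rst_trans ha (rst_sym _ _ _ _ hb).
Qed.

Lemma class_ofP Γ U B W (a b : term U Γ B W) : conv a b -> class_of a = class_of b.
Proof. by move=> h; rewrite /class_of; apply/eqmodP/asboolP. Qed.

Lemma repK Γ U B W (c : term_class U Γ B W) : class_of (rep c) = c.
Proof. exact: reprK. Qed.

Lemma rep_conv Γ U B W (a : term U Γ B W) : conv (rep (class_of a)) a.
Proof.
have : class_of (rep (class_of a)) = class_of a by apply: repK.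
by rewrite /class_of => /eqmodP/asboolP.
Qed.

(** Once the boundaries are identified, the two terms have one type, and subject reduction turns a
    common reduct into a conversion. *)
Lemma AnyCell_eq Γ Γ' U U' B W W' (a : term U Γ B W) (b : term U' Γ' B W') :
  U = U' -> Γ = Γ' -> W = W' -> join (sval a) (sval b) ->
  @AnyCell (bracket M) _ _ _ _ (class_of a) = @AnyCell (bracket M) _ _ _ _ (class_of b).
Proof.
by move=> eU eΓ eW; subst U' Γ' W' => /join_conv/class_ofP ->.
Qed.

(** * Composition respects convertibility *)

Definition tpath := cpath (@term M).
Definition cls U W Γs As (p : tpath U W Γs As) := cpath_map (@class_of M) p.
Definition reps U W Γs As (p : cpath (@term_class M) U W Γs As) : tpath U W Γs As :=
  cpath_map (@rep M) p.

Lemma repsK U W Γs As (p : cpath (@term_class M) U W Γs As) : cls (reps p) = p.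
Proof.
elim: p => //= {U W Γs As} U V W Γ A Γs As a p IH.
by rewrite /cls /= repK; apply: (congr1 (pcons a) IH).
Qed.

Lemma sval_tcomp U W P Q Γs As B (f : term P As B Q) (p : tpath U W Γs As) :
  sval (tcomp f p) = rcomp U (sval f) (raws p).
Proof. by case: p f. Qed.

(** Representatives are exchanged for the original terms from left to right; [us] is the prefix
    already treated. *)
Lemma rconv_let_reps U W Γs As (p : tpath U W Γs As) :
  forall Δs us T Bs (f : raw M) P B Q, typeds Δs us T Bs U ->
    0 < size (Bs ++ As) -> typed (Bs ++ As) f P B Q ->
  rconv (flatten (Δs ++ Γs)) (T ++ P) B (W ++ Q)
    (Let (us ++ raws (reps (cls p))) f) (Let (us ++ raws p) f).
Proof.
elim: p => {U W Γs As} [U|U V W Γ A Γs As a p IH] Δs us T Bs f P B Q tus pos tf.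
  exact: rst_refl.
apply: (rst_trans _ _ _ (Let (us ++ sval a :: raws (reps (cls p))) f)).
  have h := conv_rconv (rep_conv a).
  apply: (rconv_morph (F := fun t => Let (us ++ t :: _) f)) h => [s t|t tt].
    exact: C_let1.
  apply: T_let pos _ tf; apply: typeds_cat tus _.
  by apply: T_cons tt _; apply: raws_typed.
have := IH (rcons Δs Γ) (rcons us (sval a)) T (rcons Bs A) f P B Q.
rewrite !cat_rcons; apply=> //; rewrite -!cats1.
by apply: typeds_cat tus _; apply: T_cons (svalP a) _; apply: T_nil.
Qed.

Lemma step_idU U s t : step s t -> step (idU_raw U s) (idU_raw U t).
Proof.
move=> h; elim: U => //= -[A []] U IH.
  by apply: C_getL; apply: C_putR.
by apply: C_getR; apply: C_putL.
Qed.

(** Independence of representatives: first [f] is exchanged, below the [Let] or inside the wire,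
    then the entries of the path. *)
Lemma class_comp_class U W P Q Γs As B (f : term P As B Q) (p : tpath U W Γs As) :
  class_comp (class_of f) (cls p) = class_of (tcomp f p).
Proof.
apply: class_ofP; apply: rconv_conv; rewrite !sval_tcomp -/(reps _).
have := conv_rconv (rep_conv f); case: p f => [V|U' V W' Γ A Δs Bs a p] f hf.
  exact: rconv_morph (step_idU V) (fun t => @idU_typed M V _ _ _ t) _ _ hf.
have tus := raws_typed (reps (cls (pcons a p))).
apply: (rst_trans _ _ _ (Let (raws (reps (cls (pcons a p)))) (sval f))).
  apply: (rconv_morph (F := Let _)) hf => [s t|t tt]; first exact: C_let2.
  exact: T_let tus tt.
exact: rconv_let_reps (pcons a p) _ _ _ _ _ _ _ _ (T_nil _) _ (svalP f).
Qed.

(** * The laws, read off from chosen representatives *)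

Fixpoint tids As : tpath [::] [::] [seq [:: A] | A <- As] As :=
  match As with
  | [::] => pnil [::]
  | A :: As' => pcons (tid A) (tids As')
  end.

Lemma cls_tids As : cls (tids As) = pids (D := bracket M) As.
Proof. by elim: As => //= A As <-. Qed.

Lemma raws_tids As : raws (tids As) = [seq Seq (idarr A) | A <- As].
Proof. by elim: As => //= A As ->. Qed.

Lemma flatten_seq1s As : flatten [seq [:: A] | A <- As] = As.
Proof. by elim: As => //= A As ->. Qed.

Fixpoint tcomposites U U' T T' Ξss Γs As
    (n : cpath2 (@term_class M) U U' T T' Ξss Γs As) :
    tpath (U ++ T) (U' ++ T') (map flatten Ξss) As :=
  match n in cpath2 _ U U' T T' Ξss _ As
    return tpath (U ++ T) (U' ++ T') (map flatten Ξss) As with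
  | p2nil U T => pnil (U ++ T)
  | p2cons _ _ _ _ _ _ _ _ _ _ _ _ g hs n' =>
      pcons (tcomp (rep g) (reps hs)) (tcomposites n')
  end.

Lemma cls_tcomposites U U' T T' Ξss Γs As
    (n : cpath2 (@term_class M) U U' T T' Ξss Γs As) :
  cls (tcomposites n) = pcomposites (D := bracket M) n.
Proof. by elim: n => //= *; congr pcons. Qed.

(** The raw content of a two-level path; its three projections are the three families of the
    associativity law. *)
Fixpoint groups_of U U' T T' Ξss Γs As
    (n : cpath2 (@term_class M) U U' T T' Ξss Γs As) : seq (group M) :=
  match n with
  | p2nil _ _ => [::]
  | p2cons U _ _ _ _ _ _ _ _ _ _ _ g hs n' =>
      Group U (sval (rep g)) (raws (reps hs)) :: groups_of n'
  end.

Lemma raws_pcat T U W Γs As Δs Bs (p : cpath (@term_class M) T U Γs As)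
    (q : cpath (@term_class M) U W Δs Bs) :
  raws (reps (pcat p q)) = raws (reps p) ++ raws (reps q).
Proof.
elim: p q => //= {T U Γs As} T V U Γ A Γs As a p IH q.
by rewrite -!/(reps _) IH.
Qed.

Section GroupsOf.
Variables (U U' T T' : word M) (Ξss : seq (seq (seq (ob M)))) (Γs : seq (seq (ob M))).
Variables (As : seq (ob M)) (n : cpath2 (@term_class M) U U' T T' Ξss Γs As).

Lemma groups_ofP : groups U U' (groups_of n).
Proof.
elim: n => [V X|V V' V'' X X' X'' Ξs Γ A Ξss' Γs' As' g hs n' IH] /=.
  exact: GNil.
exact: GCons (svalP (rep g)) (raws_typed (reps hs)) IH.
Qed.

Lemma gout_groups_of : map (@gout M) (groups_of n) = raws (reps (pouter n)).
Proof. by elim: n => //= *; congr cons. Qed.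

Lemma gins_groups_of : gins (groups_of n) = raws (reps (pinner n)).
Proof.
elim: n => //= V V' V'' X X' X'' Ξs Γ A Ξss' Γs' As' g hs n' IH.
by rewrite raws_pcat -IH.
Qed.

Lemma gcomp_groups_of : map (@gcomp M) (groups_of n) = raws (tcomposites n).
Proof.
elim: n => //= V V' V'' X X' X'' Ξs Γ A Ξss' Γs' As' g hs n' ->.
by rewrite sval_tcomp.
Qed.

End GroupsOf.

Lemma flatten_map_flatten (T : Type) (s : seq (seq (seq T))) :
  flatten (map flatten s) = flatten (flatten s).
Proof. by elim: s => //= x s ->; rewrite flatten_cat. Qed.

Lemma bracket_svdc : is_svdc (bracket M).
Proof.
split.
- move=> U U' T T' P Q Ξss Γs As B f n.
  have -> : vcomp f (pcomposites n) = class_of (tcomp (rep f) (tcomposites n)).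
    by rewrite -cls_tcomposites -{1}(repK f); apply: class_comp_class.
  have -> : vcomp (vcomp f (pouter n)) (pinner n) =
      class_of (tcomp (tcomp (rep f) (reps (pouter n))) (reps (pinner n))).
    by rewrite -{1}(repsK (pinner n)); apply: class_comp_class.
  (* The two boundaries differ by associativity of concatenation and by the order of flattening. *)
  apply: AnyCell_eq; rewrite /= ?catA ?flatten_map_flatten //.
  rewrite !sval_tcomp -gcomp_groups_of -gout_groups_of -gins_groups_of.
  exact: join_rcompA (groups_ofP n).
- move=> P Q As B f.
  have -> : vcomp f (pids As) = class_of (tcomp (rep f) (tids As)).
    by rewrite -cls_tids -{1}(repK f); apply: class_comp_class.
  rewrite -{2}(repK f); apply: AnyCell_eq => //; first exact: flatten_seq1s.
  rewrite sval_tcomp raws_tids; exact: join_rcomp_unitr (svalP (rep f)).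
- move=> P Q As B f.
  have -> : vcomp (vid B) (pcons f (pnil Q)) =
      class_of (tcomp (tid B) (pcons (rep f) (pnil Q))).
    rewrite -{1}(repK f).
    exact: (class_comp_class (tid B) (pcons (rep f) (pnil Q))).
  rewrite -{2}(repK f); apply: AnyCell_eq; rewrite /= ?cats0 //.
  exact: join_unitl (svalP (rep f)).
Qed.

End Cells.

(* The first conjunct says that composition in [bracket M], defined through
   representatives, is the operation induced on classes by [tcomp]. *)
Theorem theorem4p6 (M : multicategory) :
  (forall (U W P Q : word M) (Γs : seq (seq (ob M))) (As : seq (ob M)) (B : ob M)
      (f : term P As B Q) (p : cpath (@term M) U W Γs As),
    @vcomp (bracket M) U W P Q Γs As B
      (class_of f) (cpath_map (@class_of M) p) = class_of (tcomp f p))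
  /\ is_svdc (bracket M).
Proof.
split; last exact: bracket_svdc.
move=> U W P Q Γs As B f p; exact: class_comp_class.
Qed.
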